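(* Let $R$ and $H$ be Leibniz conformal algebras and let $\mathfrak L=\mathfrak L(R\oplus H,H)$ be the associated differential graded Lie algebra. Equivalence in $Z^2_{nab}(R,H)$ coincides with equivalence in $MC(\mathfrak L)$: for two cocycles $(l,r,\chi),(l',r',\chi')\in Z^2_{nab}(R,H)$, with corresponding Maurer–Cartan elements $c,c'\in MC(\mathfrak L)$ given by $c_\lambda((a,u),(b,v))=l(a)_\lambda v+r(b)_{-\partial-\lambda}u+\chi_\lambda(a,b)$ and $c'_\lambda((a,u),(b,v))=l'(a)_\lambda v+r'(b)_{-\partial-\lambda}u+\chi'_\lambda(a,b)$, the cocycles are equivalent if and only if $c$ and $c'$ are equivalent in $MC(\mathfrak L)$.
   Context: All vector spaces are over $\mathbb C$ and all $\mathbb C[\partial]$-modules are finitely generated. A Leibniz conformal algebra is a $\mathbb C[\partial]$-module $R$ with a $\mathbb C$-bilinear $\lambda$-bracket $R\times R\to R[\lambda]$, $(a,b)\mapsto[a_\lambda b]$, such that $[(\partial a)_\lambda b]=-\lambda[a_\lambda b]$, $[a_\lambda\partial b]=(\partial+\lambda)[a_\lambda b]$ and $[a_\lambda[b_\mu c]]=[[a_\lambda b]_{\lambda+\mu}c]+[b_\mu[a_\lambda c]]$. Brackets and maps are extended linearly to polynomials in the formal variables; for $x(\lambda)=\sum_k\lambda^kx_k$, $x(-\partial-\mu)$ means $\sum_k(-\partial-\mu)^kx_k$. Cocycles. A conformal linear map $d:H\to H$ is a $\mathbb C$-linear map $d_\lambda:H\to H[\lambda]$ with $d_\lambda(\partial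 v)=(\partial+\lambda)d_\lambda(v)$; these form a $\mathbb C[\partial]$-module via $(\partial d)_\lambda=-\lambda d_\lambda$. $\mathrm{CDer}^L(H)$ is the set of conformal linear maps with $d_\lambda([u_\mu v])=[u_\mu d_\lambda(v)]+[d_\lambda(u)_{\lambda+\mu}v]$; $\mathrm{CDer}^R(H)$ is the set of those with $d_\lambda([u_\mu v])=[u_\mu d_\lambda(v)]-[v_{-\partial-\lambda-\mu}d_\lambda(u)]$. A conformal bilinear map $\chi:R\times R\to H[\lambda]$ is a $\mathbb C$-bilinear map with $\chi_\lambda(\partial a,b)=-\lambda\chi_\lambda(a,b)$, $\chi_\lambda(a,\partial b)=(\partial+\lambda)\chi_\lambda(a,b)$. A non-abelian $2$-cocycle on $R$ with values in $H$ is a triple $(l,r,\chi)$ with $\chi:R\times R\to H[\lambda]$ conformal bilinear and $l:R\to\mathrm{CDer}^L(H)$, $r:R\to\mathrm{CDer}^R(H)$ $\mathbb C[\partial]$-module homomorphisms such that for all $a,b,c\in R$, $h,h_1,h_2\in H$: (i) $[(l(a)_\lambda h_1+r(a)_\lambda h_1)_{\lambda+\mu}h_2]=0$ and $r(a)_\lambda(r(b)_\mu h+l(b)_\mu h)=0$; (ii) $l(a)_\lambda(l(b)_\mu h)-l(b)_\mu(l(a)_\lambda h)-l([a_\lambda b])_{\lambda+\mu}h=[\chi_\lambda(a,b)_{\lambda+\mu}h]$; (iii) $l(a)_\lambda(r(b)_\mu h)-r(b)_\mu(l(a)_\lambda h)-r([a_\lambda b])_{\lambda+\mu}h=[h_{-\partial-\lambda-\mu}\chi_\lambda(a,b)]$;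 (iv) $\chi_\lambda(a,[b_\mu c])-\chi_\mu(b,[a_\lambda c])-\chi_{\lambda+\mu}([a_\lambda b],c)+l(a)_\lambda\chi_\mu(b,c)-l(b)_\mu\chi_\lambda(a,c)-r(c)_{-\partial-\lambda-\mu}\chi_\lambda(a,b)=0$. $Z^2_{nab}(R,H)$ is the set of these. Two cocycles $(l,r,\chi)$, $(l',r',\chi')$ are equivalent if there is a $\mathbb C[\partial]$-module homomorphism $\beta:R\to H$ with $l'(a)_\lambda h-l(a)_\lambda h=[\beta(a)_\lambda h]$, $r'(a)_\lambda h-r(a)_\lambda h=[h_{-\partial-\lambda}\beta(a)]$ and $\chi'_\lambda(a,b)=\chi_\lambda(a,b)+l(a)_\lambda\beta(b)+r(b)_{-\partial-\lambda}\beta(a)-\beta([a_\lambda b])+[\beta(a)_\lambda\beta(b)]$. The differential graded Lie algebra $\mathfrak L$. For a $\mathbb C[\partial]$-module $E$, $C^n(E,E)$ ($n\ge1$) is the space of $\mathbb C$-linear maps $\gamma_{\lambda_1,\dots,\lambda_{n-1}}:E^{\otimes n}\to E[\lambda_1,\dots,\lambda_{n-1}]$ with $\gamma_{\lambda_1,\dots,\lambda_{n-1}}(a_1,\dots,\partial a_i,\dots,a_n)=-\lambda_i\gamma_{\lambda_1,\dots,\lambda_{n-1}}(a_1,\dots,a_n)$ for $i<n$ and $\gamma_{\lambda_1,\dots,\lambda_{n-1}}(a_1,\dots,\partial a_n)=(\partial+\lambda_1+\cdots+\lambda_{n-1})\gamma_{\lambda_1,\dots,\lambda_{n-1}}(a_1,\dots,a_n)$.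 $C^{\bullet+1}(E,E)=\bigoplus_{n\ge0}C^{n+1}(E,E)$, with $C^{n+1}(E,E)$ in degree $n$, is a graded Lie algebra under $[\gamma,\theta]=\gamma\cdot\theta-(-1)^{mn}\theta\cdot\gamma$ for $\gamma\in C^{m+1}$, $\theta\in C^{n+1}$, where $$(\gamma\cdot\theta)_{\lambda_1,\dots,\lambda_{m+n}}(a_1,\dots,a_{m+n+1})=\sum_{k=0}^m(-1)^{kn}\sum_{\sigma\in S_{(k,n)}}\mathrm{sign}(\sigma)\,\gamma_{\lambda_{\sigma(1)},\dots,\lambda_{\sigma(k)},\lambda_{\sigma(k+1)}+\cdots+\lambda_{\sigma(k+n)}+\lambda_{k+n+1},\lambda_{k+n+2},\dots,\lambda_{m+n}}\big(a_{\sigma(1)},\dots,a_{\sigma(k)},\theta_{\lambda_{\sigma(k+1)},\dots,\lambda_{\sigma(k+n)}}(a_{\sigma(k+1)},\dots,a_{\sigma(k+n)},a_{k+n+1}),a_{k+n+2},\dots,a_{m+n+1}\big),$$ $S_{(k,n)}$ being the permutations $\sigma$ of $\{1,\dots,k+n\}$ with $\sigma(1)<\dots<\sigma(k)$ and $\sigma(k+1)<\dots<\sigma(k+n)$ (for $k=m$ the $\theta$-entry is the last argument and the subscript of $\gamma$ is just $\lambda_{\sigma(1)},\dots,\lambda_{\sigma(m)}$). Take $E=R\oplus H$ and let $\pi\in C^2(E,E)$ be the direct sum bracket $\pi_\lambda((a_1,h_1),(a_2,h_2))=([{a_1}_\lambda a_2],[{h_1}_\lambda h_2])$; then $d=[\pi,\cdot]$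 is a differential. $C^{m,n}$ is the space of elements of $C^{m+n}(E,E)$ with values in $H$ which vanish on all tensor products of $m+n$ factors from $\{R,H\}$ except those with exactly $m$ factors $R$ and $n$ factors $H$. $\mathfrak L=\bigoplus_{i\ge0}\mathfrak L^i$ with $\mathfrak L^i=\bigoplus_{m+n=i+1,\,m\ge1,\,n\ge0}C^{m,n}$, a sub-differential graded Lie algebra. $MC(\mathfrak L)=\{c\in\mathfrak L^1\mid dc+\frac12[c,c]=0\}$; the assignment $(l,r,\chi)\mapsto c$ of the claim is a bijection $Z^2_{nab}(R,H)\to MC(\mathfrak L)$. Two elements $c,c'\in MC(\mathfrak L)$ are equivalent if there is $\alpha\in\mathfrak L^0$ with $c'=e^{\mathrm{ad}\,\alpha}(c)-\frac{e^{\mathrm{ad}\,\alpha}-1}{\mathrm{ad}\,\alpha}d(\alpha)$, where $\mathrm{ad}\,\alpha=[\alpha,\cdot]$ and $\frac{e^{x}-1}{x}=\sum_{n\ge0}\frac{x^n}{(n+1)!}$ (only finitely many terms are nonzero here). *)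

(* Defs.v *)
From HB Require Import structures.
From mathcomp Require Import all_boot all_fingroup all_algebra.
From mathcomp.finmap Require Import finmap.
From mathcomp.multinomials Require Import monalg.

Set Implicit Arguments.
Unset Strict Implicit.
Unset Printing Implicit Defensive.

Import GRing.Theory.
Local Open Scope ring_scope.

(* A C[d]-module is an lmodType over {poly K}, the derivation being the action
   of 'X.  The ring C[d][l_0, .., l_(n-1)] is cpoly K n, and V[l_0, .., l_(n-1)]
   is vpoly n V, a module over the former. *)

Notation cpoly K n := {malg {poly K}['X_{1..n}]}.

Definition vpoly (K : fieldType) (n : nat) (V : lmodType {poly K}) :=
  {malg V['X_{1..n}]}.

HB.instance Definition _ K n V :=
  GRing.Zmodule.on (@vpoly K n V).

HB.lock Definition vscale (K : fieldType) (n : nat) (V : lmodType {poly K})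
    (p : cpoly K n) (x : vpoly n V) : vpoly n V :=
  \sum_(k <- msupp p) \sum_(l <- msupp x) << p@_k *: x@_l *g mmul k l >>.

(* Comparing two distinct monomials by conversion is very slow. *)
Opaque mkmalgU.

Section PolynomialModule.
Variables (K : fieldType) (n : nat) (V : lmodType {poly K}).
Implicit Types (p q : cpoly K n) (x y : vpoly n V).

Local Notation vscale := (@vscale K n V).

Lemma vscaleEw (D1 D2 : {fset 'X_{1..n}}) p x :
  (msupp p `<=` D1)%fset -> (msupp x `<=` D2)%fset ->
  vscale p x = \sum_(k <- D1) \sum_(l <- D2) << p@_k *: x@_l *g mmul k l >>.
Proof.
move=> s1 s2; rewrite vscale.unlock (big_fset_incl _ s1) /=; last first.
  move=> k _ /mcoeff_outdom->; rewrite big1 // => l _.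
  by rewrite scale0r monalgU0.
apply: eq_bigr => k _; rewrite (big_fset_incl _ s2) //= => l _ /mcoeff_outdom->.
by rewrite scaler0 monalgU0.
Qed.

Lemma vscaleDl x : {morph vscale^~ x : p q / p + q}.
Proof.
move=> p q; pose D := (msupp p `|` msupp q)%fset.
rewrite (@vscaleEw D (msupp x) (p + q)) ?msuppD_le //.
rewrite (@vscaleEw D (msupp x) p) ?fsubsetUl //.
rewrite (@vscaleEw D (msupp x) q) ?fsubsetUr //.
rewrite -big_split; apply: eq_bigr => k _; rewrite -big_split.
by apply: eq_bigr => l _; rewrite mcoeffD scalerDl monalgUD.
Qed.

Lemma vscaleDr : right_distributive vscale +%R.
Proof.
move=> p x y; pose D := (msupp x `|` msupp y)%fset.
rewrite (@vscaleEw (msupp p) D p (x + y)) ?msuppD_le //.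
rewrite (@vscaleEw (msupp p) D p x) ?fsubsetUl //.
rewrite (@vscaleEw (msupp p) D p y) ?fsubsetUr //.
rewrite -big_split; apply: eq_bigr => k _; rewrite -big_split.
by apply: eq_bigr => l _; rewrite mcoeffD scalerDr monalgUD.
Qed.

Lemma vscale0l x : vscale 0 x = 0.
Proof. by rewrite vscale.unlock msupp0 big_seq_fset0. Qed.

Lemma vscale0r p : vscale p 0 = 0.
Proof. by rewrite vscale.unlock msupp0 big1 // => k _; rewrite big_seq_fset0. Qed.

Lemma vscaleUU (a : {poly K}) (k : 'X_{1..n}) (v : V) (l : 'X_{1..n}) :
  vscale << a *g k >> << v *g l >> = << a *: v *g mmul k l >>.
Proof.
rewrite (vscaleEw msuppU_le msuppU_le) !big_seq_fset1.
by rewrite !mcoeffUU.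
Qed.

Lemma vscale_suml (I : Type) (r : seq I) (F : I -> cpoly K n) x :
  vscale (\sum_(i <- r) F i) x = \sum_(i <- r) vscale (F i) x.
Proof. exact: (big_morph (vscale^~ x) (vscaleDl x) (vscale0l x)). Qed.

Lemma vscale_sumr (I : Type) (r : seq I) p (F : I -> vpoly n V) :
  vscale p (\sum_(i <- r) F i) = \sum_(i <- r) vscale p (F i).
Proof. exact: (big_morph (vscale p) (vscaleDr p) (vscale0r p)). Qed.

Lemma vpolyE x : x = \sum_(k <- msupp x) (<< x@_k *g k >> : vpoly n V).
Proof. exact: monalgE. Qed.

Lemma vscaleA p q x : vscale p (vscale q x) = vscale (p * q) x.
Proof.
rewrite [p]monalgE mulr_suml !vscale_suml; apply: eq_bigr => i _.
rewrite [q]monalgE mulr_sumr !vscale_suml vscale_sumr; apply: eq_bigr => j _.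
rewrite (vpolyE x) [X in vscale _ X = _]vscale_sumr.
rewrite [LHS]vscale_sumr [RHS]vscale_sumr; apply: eq_bigr => k _.
rewrite malgM_def fgmulUU [RHS]vscaleUU [X in vscale _ X = _]vscaleUU.
by rewrite vscaleUU scalerA mulmA.
Qed.

Lemma vscale1 : left_id 1 vscale.
Proof.
move=> x; rewrite [RHS]vpolyE {1}(vpolyE x) vscale_sumr.
by apply: eq_bigr => k _; rewrite vscaleUU scale1r mul1m.
Qed.

HB.instance Definition _ := GRing.Zmodule_isLmodule.Build (cpoly K n) (vpoly n V)
  vscaleA vscale1 vscaleDr vscaleDl.

End PolynomialModule.

Section Substitution.
Variable K : fieldType.
Implicit Types U V W : lmodType {poly K}.

(* The j-th formal variable; the value 0 for n <= j is never used. *)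
Definition lvar n (j : nat) : cpoly K n :=
  if insub j is Some i then << ucm (i : 'I_n) >> else 0.

Definition scal n (c : K) : cpoly K n := c%:P%:MP.
Definition partial n : cpoly K n := 'X%:MP.

Definition vconst n V (v : V) : vpoly n V := << v *g mone >>.

(* x(s_0, s_1, ..): the coefficients are on the right of the s_i, so that an
   'X occurring in s_i acts on the coefficients of x. *)
Definition subst n m V (s : 'I_n -> cpoly K m) (x : vpoly n V) : vpoly m V :=
  \sum_(k <- msupp x) (\prod_(i < n) s i ^+ k i) *: vconst m (x@_k).

(* Linear extension of f to polynomials in the formal variables. *)
Definition ext m V W (f : V -> vpoly m W) (x : vpoly m V) : vpoly m W :=
  \sum_(k <- msupp x) (<< k >> : cpoly K m) *: f (x@_k).

(* d_p(x) and f_p(x, y), for d : V -> W[l] and f : U -> V -> W[l]. *)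
Definition ev1 n V W (d : V -> vpoly 1 W) (p : cpoly K n) (x : vpoly n V) :
    vpoly n W :=
  ext (fun v => subst (fun=> p) (d v)) x.

Definition ev2 n U V W (f : U -> V -> vpoly 1 W) (p : cpoly K n)
    (x : vpoly n U) (y : vpoly n V) : vpoly n W :=
  ext (fun u => ev1 (f u) p y) x.

Definition vmap n V W (f : V -> W) (x : vpoly n V) : vpoly n W :=
  ext (fun v => vconst n (f v)) x.

Definition klinear n V W (f : V -> vpoly n W) :=
  forall (c : K) u v, f (c%:P *: u + v) = scal n c *: f u + f v.

End Substitution.

Arguments lvar {K n} j.
Arguments scal {K n} c.
Arguments partial {K n}.
Arguments vconst {K n V} v.

Local Notation lam := (lvar 0).
Local Notation mu := (lvar 1).
Local Notation "v '%:V'" := (vconst v) (at level 2, format "v %:V").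

Section Conformal.
Variable K : fieldType.
Implicit Types U V W : lmodType {poly K}.

Definition conformal_linear V W (d : V -> vpoly 1 W) :=
  klinear d /\ forall v, d ('X *: v) = (partial + lam) *: d v.

Definition conformal_bilinear U V W (f : U -> V -> vpoly 1 W) :=
  [/\ forall v, klinear (f^~ v), forall u, klinear (f u),
      forall u v, f ('X *: u) v = - lam *: f u v
    & forall u v, f u ('X *: v) = (partial + lam) *: f u v].

Definition finitely_generated V :=
  exists s : seq V, forall v, exists p : 'I_(size s) -> {poly K},
    v = \sum_(i < size s) p i *: s`_i.

Definition leibniz_identity V (br : V -> V -> vpoly 1 V) :=
  forall a b c : V,
    ev2 br lam a%:V (ev2 br mu b%:V c%:V) =
    ev2 br (lam + mu) (ev2 br lam a%:V b%:V) c%:V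
    + ev2 br mu b%:V (ev2 br lam a%:V c%:V) :> vpoly 2 V.

End Conformal.

Record leibnizConformalAlgebra (K : fieldType) := LeibnizConformalAlgebra {
  lca_module :> lmodType {poly K};
  lca_fg : finitely_generated lca_module;
  bracket : lca_module -> lca_module -> vpoly 1 lca_module;
  bracket_bilinear : conformal_bilinear bracket;
  bracket_leibniz : leibniz_identity bracket
}.

Section Cocycles.
Variables (K : fieldType) (R H : leibnizConformalAlgebra K).

Local Notation br p := (ev2 (@bracket K H) p).
Local Notation brR p := (ev2 (@bracket K R) p).

Definition cderL (d : H -> vpoly 1 H) :=
  conformal_linear d /\
  forall u v : H,
    ev1 d lam (br mu u%:V v%:V) =
    br mu u%:V (ev1 d lam v%:V) + br (lam + mu) (ev1 d lam u%:V) v%:V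
    :> vpoly 2 H.

Definition cderR (d : H -> vpoly 1 H) :=
  conformal_linear d /\
  forall u v : H,
    ev1 d lam (br mu u%:V v%:V) =
    br mu u%:V (ev1 d lam v%:V)
    - br (- partial - lam - mu) v%:V (ev1 d lam u%:V)
    :> vpoly 2 H.

(* C[d]-linear for the module structure (d phi)_l = - l phi_l on conformal
   linear maps. *)
Definition conformal_hom (l : R -> H -> vpoly 1 H) :=
  (forall h, klinear (l^~ h)) /\ (forall a h, l ('X *: a) h = - lam *: l a h).

Record Z2nab := NabCocycle {
  zl : R -> H -> vpoly 1 H;
  zr : R -> H -> vpoly 1 H;
  zchi : R -> R -> vpoly 1 H;
  zchi_bilinear : conformal_bilinear zchi;
  zl_hom : conformal_hom zl;
  zr_hom : conformal_hom zr;
  zl_cder : forall a, cderL (zl a);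
  zr_cder : forall a, cderR (zr a);
  cocycle_brl : forall (a : R) (h1 h2 : H),
    br (lam + mu) (ev2 zl lam a%:V h1%:V + ev2 zr lam a%:V h1%:V) h2%:V
    = 0 :> vpoly 2 H;
  cocycle_rr : forall (a b : R) (h : H),
    ev2 zr lam a%:V (ev2 zr mu b%:V h%:V + ev2 zl mu b%:V h%:V)
    = 0 :> vpoly 2 H;
  cocycle_ll : forall (a b : R) (h : H),
    ev2 zl lam a%:V (ev2 zl mu b%:V h%:V)
    - ev2 zl mu b%:V (ev2 zl lam a%:V h%:V)
    - ev2 zl (lam + mu) (brR lam a%:V b%:V) h%:V
    = br (lam + mu) (ev2 zchi lam a%:V b%:V) h%:V :> vpoly 2 H;
  cocycle_lr : forall (a b : R) (h : H),
    ev2 zl lam a%:V (ev2 zr mu b%:V h%:V)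
    - ev2 zr mu b%:V (ev2 zl lam a%:V h%:V)
    - ev2 zr (lam + mu) (brR lam a%:V b%:V) h%:V
    = br (- partial - lam - mu) h%:V (ev2 zchi lam a%:V b%:V) :> vpoly 2 H;
  cocycle_chi : forall a b c : R,
    ev2 zchi lam a%:V (brR mu b%:V c%:V)
    - ev2 zchi mu b%:V (brR lam a%:V c%:V)
    - ev2 zchi (lam + mu) (brR lam a%:V b%:V) c%:V
    + ev2 zl lam a%:V (ev2 zchi mu b%:V c%:V)
    - ev2 zl mu b%:V (ev2 zchi lam a%:V c%:V)
    - ev2 zr (- partial - lam - mu) c%:V (ev2 zchi lam a%:V b%:V)
    = 0 :> vpoly 2 H
}.

Definition Z2nab_equiv (z z' : Z2nab) :=
  exists beta : {linear R -> H},
  [/\ forall (a : R) (h : H),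
        zl z' a h - zl z a h = bracket (beta a) h,
      forall (a : R) (h : H),
        zr z' a h - zr z a h
        = br (- partial - lam) h%:V (beta a)%:V
    & forall a b : R,
        zchi z' a b =
        zchi z a b + zl z a (beta b)
        + ev2 (zr z) (- partial - lam) b%:V (beta a)%:V
        - vmap beta (bracket a b) + bracket (beta a) (beta b)].

End Cocycles.

Section Cochains.
Variables (K : fieldType) (E : lmodType {poly K}).

(* Degree n of the graded Lie algebra: n + 1 arguments, n formal variables. *)
Definition cochain (n : nat) := {ffun 'I_n.+1 -> E} -> vpoly n E.

Definition upd n (a : {ffun 'I_n -> E}) (i : 'I_n) (u : E) : {ffun 'I_n -> E} :=
  [ffun j => if j == i then u else a j].

Definition is_cochain n (g : cochain n) :=
  [/\ forall i a, klinear (fun u => g (upd a i u)),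
      forall (i : 'I_n.+1) a, (i < n)%N ->
        g (upd a i ('X *: a i)) = - lvar i *: g a
    & forall a, g (upd a ord_max ('X *: a ord_max))
        = (partial + \sum_(i < n) lvar i) *: g a].

Definition shuffle k n (s : 'S_(k + n)) :=
  [forall i : 'I_(k + n), forall j : 'I_(k + n),
     ((i < j < k) || (k <= i < j))%N ==> (s i < s j)%N].

(* s on 0, .., N - 1, extended by the identity. *)
Definition permn N (s : 'S_N) (j : nat) : nat :=
  if insub j is Some i then val (s i) else j.

(* g . t for g of degree m and t of degree n, with indices starting from 0.
   The degree p of the result is always m + n; it is a parameter so that g . t
   and t . g have the same type. *)
Definition circ p m n (g : cochain m) (t : cochain n) : cochain p := fun a =>
  \sum_(k < m.+1) (-1) ^+ (k * n) *: \sum_(s : 'S_(k + n) | shuffle s)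
    let arg j := a (inord (permn s j)) in
    let var j := lvar (permn s j) : cpoly K p in
    (-1) ^+ odd_perm s *:
    ext (fun e => subst
           (fun j : 'I_m =>
              if (j < k)%N then var j
              else if j == k :> nat then \sum_(i < n.+1) var (k + i)%N
              else var (j + n)%N)
           (g [ffun j : 'I_m.+1 =>
                 if (j < k)%N then arg j
                 else if j == k :> nat then e
                 else arg (j + n)%N]))
        (subst (fun j : 'I_n => var (k + j)%N)
           (t [ffun j : 'I_n.+1 => arg (k + j)%N])).

Definition gbracket m n (g : cochain m) (t : cochain n) : cochain (m + n)%N :=
  fun a => @circ (m + n) m n g t a - (-1) ^+ (m * n) *: @circ (m + n) n m t g a.

End Cochains.

Section DGLA.
Variables (K : fieldType) (R H : leibnizConformalAlgebra K).

Definition dsum : lmodType {poly K} := (R * H)%type.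

Definition inR (x : R) : dsum := (x, 0).
Definition inH (y : H) : dsum := (0, y).

Definition dsum_bracket : cochain dsum 1 := fun a =>
  vmap inR (bracket (a ord0).1 (a ord_max).1)
  + vmap inH (bracket (a ord0).2 (a ord_max).2).

Definition differential n (g : cochain dsum n) : cochain dsum n.+1 :=
  gbracket dsum_bracket g.

(* C^{m,n}, inside the cochains of degree i = m + n - 1. *)
Definition bidegree m n i (g : cochain dsum i) :=
  [/\ is_cochain g,
      forall a k, ((g a)@_k).1 = 0
    & forall (S : {set 'I_i.+1}) (a : {ffun 'I_i.+1 -> dsum}),
        (forall j, j \in S -> (a j).2 = 0) ->
        (forall j, j \notin S -> (a j).1 = 0) ->
        ~ (#|S| = m /\ #|~: S| = n) -> g a = 0].

Definition in_dgla i (g : cochain dsum i) :=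
  exists f : 'I_i.+1 -> cochain dsum i,
    (forall m : 'I_i.+1, bidegree m.+1 (i - m) (f m)) /\ g =1 (fun a => \sum_m f m a).

Definition is_MC (c : cochain dsum 1) :=
  in_dgla c /\
  forall a, differential c a + scal (2%:R^-1) *: gbracket c c a = 0.

Definition adj (alpha : cochain dsum 0) n (g : cochain dsum n) : cochain dsum n :=
  gbracket alpha g.

(* s is the sum of the u k, all but finitely many of which are zero. *)
Definition finite_sum n (u : nat -> cochain dsum n) (s : cochain dsum n) :=
  exists N : nat, (forall k, (N <= k)%N -> forall a, u k a = 0) /\
    s =1 (fun a => \sum_(k < N) u k a).

Definition MC_equiv (c c' : cochain dsum 1) :=
  [/\ is_MC c, is_MC c' &
   exists (alpha : cochain dsum 0) (e1 e2 : cochain dsum 1),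
     [/\ in_dgla alpha,
         finite_sum
           (fun k a => scal ((k`!)%:R^-1) *: iter k (@adj alpha 1) c a) e1,
         finite_sum
           (fun k a => scal ((k.+1`!)%:R^-1)
                       *: iter k (@adj alpha 1) (differential alpha) a) e2
       & c' =1 (fun a => e1 a - e2 a)]].

Definition MC_of_cocycle (z : Z2nab R H) : cochain dsum 1 := fun a =>
  let: (x, u) := a ord0 in let: (y, v) := a ord_max in
  vmap inH (zl z x v + ev2 (zr z) (- partial - lam) y%:V u%:V + zchi z x y).

End DGLA.

(* Main.v *)
Require Import Defs.
From HB Require Import structures.
From mathcomp Require Import all_boot all_fingroup all_algebra.
From mathcomp Require Import ssrAC ring.
From mathcomp.finmap Require Import finmap.
From mathcomp.multinomials Require Import monalg.
From mathcomp Require Import reals.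
From mathcomp.real_closed Require Import complex.

(** Write a in L^0 as (x, u) |-> (0, - beta x) for a C[d]-linear beta : R -> H.
    As a kills H, on H-valued cochains [a, -] amounts to inserting beta into one
    argument at a time.  Hence [a, c] and [a, da] depend on R-components only,
    both are killed by [a, -], and
      e^(ad a) c - (e^(ad a) - 1)/(ad a) (da) = c + [a, c] - da - [a, da] / 2.
    Its values on R x H, H x R and R x R are the three equations that define
    equivalence of cocycles.

    That c is a Maurer-Cartan element is the identity pi.c + c.pi + c.c = 0,
    the sum of one identity for each of the seven patterns of arguments in R
    and H other than H, H, H.  Each follows from the cocycle axioms after
    substitutions of the formal variables such as m := - d - l - m.  A nested term
    f_p(g_q(u, v), w) depends on q only through q with 'X := - p, and
    f_p(w, g_q(u, v)) only through q with 'X := 'X + p; this accounts for every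
    change of subscripts. *)

Set Implicit Arguments.
Unset Strict Implicit.
Unset Printing Implicit Defensive.

Import GRing.Theory.
Local Open Scope ring_scope.

Local Notation lam := (lvar 0).
Local Notation mu := (lvar 1).
Local Notation "v '%:V'" := (vconst v) (at level 2, format "v %:V").

(** * Polynomials in the formal variables *)

(** The obstacle is that 'X acts on coefficients, so a scalar changes when it leaves an argument of
    a bracket or passes a substitution. [subst], [vmap] and, for a conformal bilinear map, [ev2] in
    either argument are additive and semilinear along a ring morphism [csub t s]. Two such maps
    agree once their morphisms agree on 'X and on the formal variables and the maps agree on
    constants. This proves every change of subscripts: in the left argument of a bracket with
    subscript p, 'X is read as - p, in the right one as 'X + p. The axioms are stated for r(b)_l,
    while c contains r(b) with subscript - d - l; this forces the changes of variables. Axiom (i)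
    supplies what the derivation rules and (iii) lack: it trades l for - r inside a bracket or under
    r. Every element of L^0 comes from some beta because the only bidegree there is (1, 0): a map
    that kills H and takes values in H. The minus sign cancels the one in [a, c] = - c.a. The only
    denominators are the 1/2 of the Maurer-Cartan equation and the 1/2! of the exponential series,
    so the argument runs over any field with 2 nonzero. *)

Section FormalVariables.
Variables (K : fieldType).

Lemma scal_is_additive n : additive (@scal K n).
Proof. by move=> c d; rewrite /scal polyCB monalgUB. Qed.

Lemma scal_is_multiplicative n : multiplicative (@scal K n).
Proof. by split=> [c d|]; rewrite /scal ?polyC1 ?mpolyC1E // polyCM mpolyCM. Qed.

HB.instance Definition _ n :=
  GRing.isAdditive.Build K (cpoly K n) (@scal K n) (@scal_is_additive n).
HB.instance Definition _ n :=
  GRing.isMultiplicative.Build K (cpoly K n) (@scal K n)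
    (@scal_is_multiplicative n).

Lemma lvarE n (i : 'I_n) : lvar i = << ucm i >> :> cpoly K n.
Proof. by rewrite /lvar valK. Qed.

Lemma monom_prod n (k : 'X_{1..n}) :
  << k >> = \prod_(i < n) lvar i ^+ k i :> cpoly K n.
Proof.
pose P (d : nat) := forall k : 'X_{1..n}, mdeg k = d ->
  << k >> = \prod_(i < n) lvar i ^+ k i :> cpoly K n.
suff H d : P d by apply: (H (mdeg k)).
elim: d => [|d IH] {}k.
  move=> /mdeg_eq0I ->; rewrite big1 ?mpolyC1E // => i _.
  by rewrite cm1 expr0.
move=> dk; have [i ki] : exists i, (0 < k i)%N.
  apply/existsP; apply: contraT; rewrite negb_exists => /forallP k0.
  suff : mdeg k = 0%N by rewrite dk.
  rewrite mdegE big1_seq // => i _.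
  by apply/eqP; rewrite -leqn0 leqNgt k0.
pose k' : 'X_{1..n} := divcm k (ucm i).
have kE : k = mmul (ucm i) k'.
  apply/eqP/cmP => j; rewrite cmM divcmE cmU.
  by case: eqP => [<-|_]; rewrite ?subn0 // subnKC.
have dk' : mdeg k' = d by move: dk; rewrite kE mdegM mdegU => -[].
have -> : << k >> = lvar i * << k' >> :> cpoly K n.
  by rewrite lvarE malgM_def fgmulUU mulr1 -kE.
rewrite (IH _ dk').
rewrite (bigD1 i isT).
rewrite [RHS](bigD1 i isT).
rewrite mulrA -exprS.
congr (_ * _).
  by congr (_ ^+ _); rewrite kE cmM cmU eqxx.
apply: eq_bigr => j ji; congr (_ ^+ _).
by rewrite kE cmM cmU eq_sym (negbTE ji).
Qed.

(** Scalars, 'X and the formal variables generate the ring; hence ring morphisms are compared on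
    these alone. *)
Lemma cpoly_ind n (P : cpoly K n -> Prop) :
  (forall c, P (scal c)) -> P partial -> (forall i : 'I_n, P (lvar i)) ->
  (forall p q, P p -> P q -> P (p + q)) ->
  (forall p q, P p -> P q -> P (p * q)) -> forall p, P p.
Proof.
move=> Ps Pd Pv PD PM p.
have P0 : P 0 by move: (Ps 0); rewrite (raddf0 (@scal K n)).
have P1 : P 1 by move: (Ps 1); rewrite (rmorph1 (@scal K n)).
have PX q k : P q -> P (q ^+ k).
  by move=> Pq; elim: k => [|k IH]; rewrite ?expr0 // exprS; apply: PM.
rewrite (monalgE p); apply: (big_ind P P0 PD) => k _.
have -> : << p@_k *g k >> = (p@_k)%:MP * << k >>.
  by rewrite malgM_def fgmulUU mulr1 mul1m.
apply: (PM); last first.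
  by rewrite monom_prod; apply: (big_ind P P1 PM) => i _; apply: PX.
elim/poly_ind: (p@_k) => [|a c IH]; first by rewrite malgC0E; exact: P0.
by rewrite monalgUD mpolyCM; exact: (PD _ _ (PM _ _ IH Pd) (Ps c)).
Qed.

Lemma cpoly_morph_ext n m (f g : {rmorphism cpoly K n -> cpoly K m}) :
  (forall c, f (scal c) = g (scal c)) -> f partial = g partial ->
  (forall i : 'I_n, f (lvar i) = g (lvar i)) -> f =1 g.
Proof.
move=> fs fd fv; apply: cpoly_ind => // p q fp fq.
  by rewrite !rmorphD fp fq.
by rewrite !rmorphM fp fq.
Qed.

Section Substitution.
Variables (n m : nat) (t : cpoly K m) (s : 'I_n -> cpoly K m).

Definition msub (k : 'X_{1..n}) := \prod_(i < n) s i ^+ k i.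

Lemma msub_is_multiplicative : mmorphism msub.
Proof.
split=> [k l|]; rewrite /msub.
  by rewrite -big_split; apply: eq_bigr => i _; rewrite cmM exprD.
by rewrite big1 // => i _; rewrite cm1 expr0.
Qed.

HB.instance Definition _ := isMultiplicative.Build _ _ msub
  msub_is_multiplicative.

(* 'X |-> t, l_i |-> s i *)
Definition csub : cpoly K n -> cpoly K m :=
  mmap (horner_morph (fun c : K => mulrC t (scal c))) msub.

HB.instance Definition _ := GRing.RMorphism.on csub.

Lemma csub_monom k : csub << k >> = msub k.
Proof. by rewrite /csub mmapU -polyC1 /= horner_morphC rmorph1 mul1r. Qed.

Lemma csubC c : csub (scal c) = scal c.
Proof. by rewrite /csub mmapC /= horner_morphC. Qed.

Lemma csubX : csub partial = t.
Proof. by rewrite /csub mmapC /= horner_morphX. Qed.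

Lemma csub_var (i : 'I_n) : csub (lvar i) = s i.
Proof.
rewrite lvarE csub_monom /msub (bigD1 i) //= cmUU expr1 big1 ?mulr1 // => j ji.
by rewrite cmU eq_sym (negbTE ji).
Qed.

End Substitution.

Lemma csub_id n : csub partial (fun i : 'I_n => lvar i) =1 id.
Proof.
apply: (@cpoly_morph_ext n n (csub _ _) idfun) => [c||i] /=.
- exact: csubC.
- exact: csubX.
- exact: csub_var.
Qed.

End FormalVariables.

(** * Semilinear maps between modules of polynomials *)

Section PolynomialsWithCoefficients.
Variables (K : fieldType).
Implicit Types U V W : lmodType {poly K}.

Section Generators.
Variables (n : nat) (V : lmodType {poly K}).
Implicit Types (x y : vpoly n V) (q : cpoly K n).

Lemma vpoly_indU (P : vpoly n V -> Prop) :
  P 0 -> (forall x y, P x -> P y -> P (x + y)) ->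
  (forall v k, P << v *g k >>) -> forall x, P x.
Proof.
move=> P0 PD PU x; rewrite (vpolyE x).
by apply: (big_ind P P0 PD) => k _; exact: PU.
Qed.

Lemma monomZ k l (v : V) :
  (<< k >> : cpoly K n) *: (<< v *g l >> : vpoly n V) = << v *g mmul k l >>.
Proof. by rewrite -[in RHS](scale1r v); exact: vscaleUU. Qed.

Lemma monomZV k (v : V) :
  << v *g k >> = (<< k >> : cpoly K n) *: v%:V :> vpoly n V.
Proof. by rewrite monomZ mulm1. Qed.

Lemma malgCZ (a : {poly K}) k (v : V) :
  (a%:MP : cpoly K n) *: (<< v *g k >> : vpoly n V) = << a *: v *g k >>.
Proof. by rewrite -[k in RHS]mul1m; exact: vscaleUU. Qed.

Lemma scalZU (c : K) k (v : V) :
  scal c *: (<< v *g k >> : vpoly n V) = << c%:P *: v *g k >>.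
Proof. exact: malgCZ. Qed.

Lemma partialZU k (v : V) :
  partial *: (<< v *g k >> : vpoly n V) = << 'X *: v *g k >>.
Proof. exact: malgCZ. Qed.

Lemma vconstZ (a : {poly K}) (v : V) :
  (a *: v)%:V = (a%:MP : cpoly K n) *: v%:V :> vpoly n V.
Proof. by rewrite malgCZ. Qed.

Lemma vconstX (v : V) : ('X *: v)%:V = partial *: v%:V :> vpoly n V.
Proof. exact: vconstZ. Qed.

Lemma vconstD (u v : V) : (u + v)%:V = u%:V + v%:V :> vpoly n V.
Proof. exact: monalgUD. Qed.

Lemma vconst0 : (0 : V)%:V = 0 :> vpoly n V.
Proof. exact: monalgU0. Qed.

Lemma vconst_inj : injective (@vconst K n V).
Proof.
move=> u v uv; rewrite -[u](mcoeffUU (mone : 'X_{1..n})).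
by rewrite -[v](mcoeffUU (mone : 'X_{1..n})) -/(vconst u) uv.
Qed.

Lemma vgen_ind (P : vpoly n V -> Prop) :
  P 0 -> (forall x y, P x -> P y -> P (x + y)) ->
  (forall q v, P (q *: v%:V)) -> forall x, P x.
Proof.
move=> P0 PD PU; apply: (vpoly_indU P0 PD) => v k.
by rewrite monomZV; exact: PU.
Qed.

End Generators.

(* Stated for an abstract F: rewriting with an equation on a concrete one
   compares distinct polynomials by conversion, which is very slow.  For the
   same reason many proofs below chain etrans and congr instead. *)
Lemma semilinear_morph n m V W (F : vpoly n V -> vpoly m W) (t : cpoly K m)
    (s : 'I_n -> cpoly K m) :
  let U (v : V) (k : 'X_{1..n}) : vpoly n V := << v *g k >> in
  {morph F : x y / x + y} ->
  (forall (c : K) v k, F ((scal c : cpoly K n) *: U v k) = scal c *: F (U v k)) ->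
  (forall v k, F ((partial : cpoly K n) *: U v k) = t *: F (U v k)) ->
  (forall (i : 'I_n) v k, F ((lvar i : cpoly K n) *: U v k) = s i *: F (U v k)) ->
  forall q x, F (q *: x) = csub t s q *: F x.
Proof.
move=> U FD Fs Fd Fv.
have F0 : F 0 = 0 by apply: (addrI (F 0)); rewrite -FD !addr0.
have ext_gen (p : cpoly K n) (p' : cpoly K m) :
  (forall v k, F (p *: U v k) = p' *: F (U v k)) ->
  forall x, F (p *: x) = p' *: F x.
- move=> Fp; apply: vpoly_indU => [|x y IHx IHy|v k]; last exact: Fp.
  + by rewrite scaler0 F0 scaler0.
  + by rewrite scalerDr !FD IHx IHy scalerDr.
apply: cpoly_ind => [c|||p q IHp IHq|p q IHp IHq].
- by rewrite csubC; apply: ext_gen.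
- by rewrite csubX; apply: ext_gen.
- by move=> i; rewrite csub_var; apply: ext_gen.
- by move=> x; rewrite scalerDl FD IHp IHq rmorphD scalerDl.
- by move=> x; rewrite -scalerA IHp IHq rmorphM scalerA.
Qed.

Lemma scale_swap n V (a b : cpoly K n) (x : vpoly n V) :
  a *: (b *: x) = b *: (a *: x).
Proof. by rewrite [LHS]scalerA [RHS]scalerA [a * b]mulrC. Qed.

Section Ext.
Variables (n : nat) (V W : lmodType {poly K}).
Implicit Types (x y : vpoly n V) (q : cpoly K n) (f g : V -> vpoly n W).

Lemma extEw f (D : {fset 'X_{1..n}}) x : f 0 = 0 -> (msupp x `<=` D)%fset ->
  ext f x = \sum_(k <- D) (<< k >> : cpoly K n) *: f (x@_k).
Proof.
move=> f0 s; rewrite /ext (big_fset_incl _ s) //= => k _ /mcoeff_outdom->.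
by rewrite f0 scaler0.
Qed.

Lemma ext0 f : ext f 0 = 0.
Proof. by rewrite /ext msupp0 big_seq_fset0. Qed.

Lemma klinearD f : klinear f -> {morph f : u v / u + v}.
Proof.
move=> fl u v; have := fl 1 u v.
by rewrite polyC1 scale1r => ->; rewrite rmorph1 scale1r.
Qed.

Lemma morphD0 (A B : zmodType) (f : A -> B) : {morph f : u v / u + v} -> f 0 = 0.
Proof. by move=> fD; apply: (addrI (f 0)); rewrite -fD !addr0. Qed.

Lemma klinearZ f : klinear f -> forall c u, f (c%:P *: u) = scal c *: f u.
Proof.
move=> fl c u; have := fl c u 0; rewrite addr0 => ->.
by rewrite (morphD0 (klinearD fl)) addr0.
Qed.

Lemma extD f : {morph f : u v / u + v} -> {morph ext f : x y / x + y}.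
Proof.
move=> fD x y; pose D := (msupp x `|` msupp y)%fset.
have f0 := morphD0 fD.
rewrite !(@extEw f D) ?msuppD_le ?fsubsetUl ?fsubsetUr //.
rewrite -big_split; apply: eq_bigr => k _.
by rewrite mcoeffD fD scalerDr.
Qed.

Lemma extU f v k : f 0 = 0 ->
  ext f (<< v *g k >> : vpoly n V) = (<< k >> : cpoly K n) *: f v.
Proof.
by move=> f0; rewrite (extEw f0 msuppU_le) big_seq_fset1 mcoeffUU.
Qed.

Lemma extV f v : f 0 = 0 -> ext f v%:V = f v.
Proof.
move=> f0; rewrite (extU _ _ f0).
by rewrite [<< _ >>]mpolyC1E scale1r.
Qed.

Lemma eq_ext f g : f =1 g -> ext f =1 ext g.
Proof. by move=> fg x; apply: eq_bigr => k _; rewrite fg. Qed.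

Lemma ext_fD f g x : ext (fun v => f v + g v) x = ext f x + ext g x.
Proof.
by rewrite -big_split; apply: eq_bigr => k _; rewrite scalerDr.
Qed.

Lemma ext_fZ q f x : ext (fun v => q *: f v) x = q *: ext f x.
Proof.
rewrite /ext scaler_sumr; apply: eq_bigr => k _.
exact: scale_swap.
Qed.

(** Formal variables pass through [ext f] unchanged; 'X is absorbed by the coefficients and comes
    out of f as t. *)
Lemma ext_semilinear f (t : cpoly K n) :
  klinear f -> (forall u, f ('X *: u) = t *: f u) ->
  forall q x, ext f (q *: x) = csub t (fun i : 'I_n => lvar i) q *: ext f x.
Proof.
move=> fl fX; have fD := klinearD fl; have f0 := morphD0 fD.
apply: semilinear_morph => [|c v k|v k|i v k]; first exact: extD.
- rewrite scalZU [LHS](extU _ _ f0) [in RHS](extU _ _ f0) (klinearZ fl).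
  exact: scale_swap.
- rewrite partialZU [LHS](extU _ _ f0) [in RHS](extU _ _ f0) fX.
  exact: scale_swap.
- rewrite lvarE monomZ [LHS](extU _ _ f0) [in RHS](extU _ _ f0) [RHS]scalerA.
  by congr (_ *: _); rewrite malgM_def fgmulUU mulr1.
Qed.

End Ext.

Section Subst.
Variables (n m : nat) (V : lmodType {poly K}) (s : 'I_n -> cpoly K m).
Implicit Types (x y : vpoly n V).

Lemma substEw (D : {fset 'X_{1..n}}) x : (msupp x `<=` D)%fset ->
  subst s x = \sum_(k <- D) msub s k *: (x@_k)%:V.
Proof.
move=> sD; rewrite /subst (big_fset_incl _ sD) //= => k _ /mcoeff_outdom->.
by rewrite vconst0 scaler0.
Qed.

Lemma substD : {morph @subst K n m V s : x y / x + y}.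
Proof.
move=> x y; pose D := (msupp x `|` msupp y)%fset.
rewrite !(@substEw D) ?msuppD_le ?fsubsetUl ?fsubsetUr //.
rewrite -big_split; apply: eq_bigr => k _.
by rewrite mcoeffD vconstD scalerDr.
Qed.

Lemma subst0 : subst s (0 : vpoly n V) = 0.
Proof. exact: morphD0 substD. Qed.

Lemma substN x : subst s (- x) = - subst s x.
Proof. by apply: (addrI (subst s x)); rewrite -substD !addrN subst0. Qed.

Lemma substB x y : subst s (x - y) = subst s x - subst s y.
Proof. by rewrite substD substN. Qed.

Lemma substU (v : V) k : subst s (<< v *g k >> : vpoly n V) = msub s k *: v%:V.
Proof. by rewrite (substEw msuppU_le) big_seq_fset1 mcoeffUU. Qed.

Lemma substV (v : V) : subst s v%:V = v%:V.
Proof. by rewrite substU mmorph1 scale1r. Qed.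

Lemma substZ q x : subst s (q *: x) = csub partial s q *: subst s x.
Proof.
move: q x; apply: semilinear_morph => [|c v k|v k|i v k]; first exact: substD.
- rewrite scalZU [LHS]substU [in RHS]substU vconstZ.
  exact: scale_swap.
- rewrite partialZU [LHS]substU [in RHS]substU vconstX.
  exact: scale_swap.
- rewrite lvarE monomZ [LHS]substU [in RHS]substU [RHS]scalerA.
  by congr (_ *: _); rewrite mmorphM /= -(csub_monom partial s (ucm i)) -lvarE csub_var.
Qed.

End Subst.

Lemma eq_subst n m V (s t : 'I_n -> cpoly K m) : s =1 t ->
  @subst K n m V s =1 subst t.
Proof.
move=> st x; rewrite /subst; apply: eq_bigr => k _.
apply: (congr1 (fun p : cpoly K m => p *: (x@_k)%:V)).
by apply: eq_bigr => i _; rewrite st.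
Qed.

Lemma substK n V (x : vpoly n V) : subst (fun i : 'I_n => lvar i) x = x.
Proof.
move: x; apply: vgen_ind => [|x y IHx IHy|q v]; first exact: subst0.
  by rewrite substD IHx IHy.
by rewrite substZ substV csub_id.
Qed.

Lemma csub_comp n m p t (s : 'I_n -> cpoly K m) (t' : cpoly K p) s' q :
  csub t' s' (csub t s q) = csub (csub t' s' t) (fun i => csub t' s' (s i)) q.
Proof.
move: q; apply: (@cpoly_morph_ext _ _ _ (csub t' s' \o csub t s) (csub _ _)).
- by move=> c; rewrite /= !csubC.
- by rewrite /= !csubX.
- by move=> i; rewrite /= !csub_var.
Qed.

Lemma eq_csub n m t t' (s s' : 'I_n -> cpoly K m) : t = t' -> s =1 s' ->
  csub t s =1 csub t' s'.
Proof.
move=> <- ss'; apply: (@cpoly_morph_ext _ _ _ (csub t s) (csub t s')) => [c||i] /=.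
- by rewrite !csubC.
- by rewrite !csubX.
- by rewrite !csub_var ss'.
Qed.

(** Recording the pair (t, s) makes the ring morphism of a composite computable, as in
    [semilin_comp]. *)
Definition semilin n m V W (t : cpoly K m) (s : 'I_n -> cpoly K m)
    (F : vpoly n V -> vpoly m W) :=
  {morph F : x y / x + y} /\ forall q x, F (q *: x) = csub t s q *: F x.

Lemma semilin_comp n m p V W X t s t' s' (F : vpoly n V -> vpoly m W)
    (G : vpoly m W -> vpoly p X) : semilin t s F -> semilin t' s' G ->
  semilin (csub t' s' t) (fun i => csub t' s' (s i)) (fun x => G (F x)).
Proof.
move=> [FD FZ] [GD GZ]; split=> [x y|q x]; first by rewrite FD GD.
by rewrite FZ GZ csub_comp.
Qed.

(** The main tool for equalities below: constants generate the module, so only t, s and the values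
    on constants have to be compared. *)
Lemma semilin_ext n m V W t s t' s' (F G : vpoly n V -> vpoly m W) :
  semilin t s F -> semilin t' s' G -> t = t' -> s =1 s' ->
  (forall v, F v%:V = G v%:V) -> F =1 G.
Proof.
move=> [FD FZ] [GD GZ] tE sE FG; apply: vgen_ind => [|x y IHx IHy|q v].
- by rewrite (morphD0 FD) (morphD0 GD).
- by rewrite FD GD IHx IHy.
- by rewrite FZ GZ FG (eq_csub tE sE).
Qed.

Lemma semilin_subst n m V (s : 'I_n -> cpoly K m) :
  semilin partial s (@subst K n m V s).
Proof. split; [exact: substD | exact: substZ]. Qed.

Lemma subst_comp n m p V (s : 'I_n -> cpoly K m) (s' : 'I_m -> cpoly K p)
    (x : vpoly n V) :
  subst s' (subst s x) = subst (fun i => csub partial s' (s i)) x.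
Proof.
apply: (semilin_ext (semilin_comp (semilin_subst V s) (semilin_subst V s'))
                    (semilin_subst V _)) => [|//|v]; first exact: csubX.
by apply: etrans (congr1 _ (substV s v)) _; rewrite [LHS]substV [RHS]substV.
Qed.

Lemma vmapK_linear V W n (f : {linear V -> W}) :
  klinear (fun v => (f v)%:V : vpoly n W).
Proof. by move=> c u v; rewrite linearP vconstD vconstZ. Qed.

Section VMap.
Variables (V W : lmodType {poly K}) (f : {linear V -> W}) (n : nat).

Lemma vmapD : {morph @vmap K n V W f : x y / x + y}.
Proof. exact: (extD (klinearD (vmapK_linear n f))). Qed.

Lemma vmap0 : vmap f (0 : vpoly n V) = 0.
Proof. exact: ext0. Qed.

Lemma vmapZ (q : cpoly K n) x : vmap f (q *: x) = q *: vmap f x.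
Proof.
rewrite /vmap (ext_semilinear (t := partial) (vmapK_linear n f)) => [|u].
  by rewrite csub_id.
by rewrite linearZ vconstX.
Qed.

Lemma vmapV v : vmap f (v%:V : vpoly n V) = (f v)%:V.
Proof. by rewrite /vmap extV //; rewrite linear0 vconst0. Qed.

Lemma vmapN : {morph @vmap K n V W f : x / - x}.
Proof. by move=> x; rewrite -scaleN1r vmapZ scaleN1r. Qed.

Lemma vmap_coef (x : vpoly n V) k : (vmap f x)@_k = f (x@_k).
Proof.
move: x; apply: vpoly_indU => [|x y IHx IHy|v l].
- by rewrite vmap0 [LHS]mcoeff0 [in RHS]mcoeff0 linear0.
- by rewrite vmapD [LHS]mcoeffD [in RHS]mcoeffD linearD; exact: congr2 IHx IHy.
- rewrite monomZV vmapZ vmapV -[in LHS]monomZV -[in RHS]monomZV.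
  rewrite [in LHS]mcoeffU [in RHS]mcoeffU.
  by case: eqP => _; rewrite ?mulr1n ?mulr0n ?linear0.
Qed.

End VMap.

Lemma semilin_vmap V W (f : {linear V -> W}) n :
  semilin partial (fun i : 'I_n => lvar i) (@vmap K n V W f).
Proof. by split=> [|q x]; [exact: vmapD | rewrite vmapZ csub_id]. Qed.

Lemma subst_vmap V W (f : {linear V -> W}) n m (s : 'I_n -> cpoly K m) x :
  subst s (vmap f x) = vmap f (subst s x).
Proof.
apply: (semilin_ext (semilin_comp (semilin_vmap f n) (semilin_subst W s))
  (semilin_comp (semilin_subst V s) (semilin_vmap f m))) => [|i|v].
- by rewrite !csubX.
- by rewrite csub_var csub_id.
- by rewrite vmapV [LHS]substV [in RHS]substV vmapV.
Qed.

Section Evaluation.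
Variables (n : nat) (U V W : lmodType {poly K}) (f : U -> V -> vpoly 1 W).
Hypothesis fbil : conformal_bilinear f.
Implicit Types (x : vpoly n U) (y : vpoly n V) (p q : cpoly K n).

Let fl := let: And4 a b c d := fbil in a.
Let fr := let: And4 a b c d := fbil in b.
Let fXl := let: And4 a b c d := fbil in c.
Let fXr := let: And4 a b c d := fbil in d.

Let sZ p c (w : vpoly 1 W) :
  subst (fun=> p) (scal c *: w) = scal c *: subst (fun=> p) w.
Proof. by rewrite substZ csubC. Qed.

Let evr_klinear p u : klinear (fun v => subst (fun=> p) (f u v)).
Proof. by move=> c v v'; rewrite fr substD sZ. Qed.

Let evrX p u v : subst (fun=> p) (f u ('X *: v)) =
  (partial + p) *: subst (fun=> p) (f u v).
Proof. by rewrite fXr substZ rmorphD /= csubX (csub_var _ _ ord0). Qed.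

Lemma ev1Dr p u : {morph ev1 (f u) p : y z / y + z}.
Proof. exact: extD (klinearD (evr_klinear p u)). Qed.

Let evl_klinear p y : klinear (fun u => ev1 (f u) p y).
Proof.
move=> c u u'; rewrite /ev1 -ext_fZ -ext_fD; apply: eq_ext => v.
by rewrite fl substD sZ.
Qed.

Let evlX p y u : ev1 (f ('X *: u)) p y = (- p) *: ev1 (f u) p y.
Proof.
rewrite /ev1 -ext_fZ; apply: eq_ext => v.
by rewrite fXl substZ rmorphN /= (csub_var _ _ ord0).
Qed.

Lemma ev2Dl p y : {morph (ev2 f p)^~ y : x z / x + z}.
Proof. exact: extD (klinearD (evl_klinear p y)). Qed.

Lemma ev2Dr p x : {morph ev2 f p x : y z / y + z}.
Proof.
move=> y z; rewrite /ev2 -ext_fD; apply: eq_ext => u.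
exact: ev1Dr.
Qed.

Lemma ev2V1 p u y : ev2 f p u%:V y = ev1 (f u) p y.
Proof. by rewrite /ev2 extV //; exact: morphD0 (klinearD (evl_klinear p y)). Qed.

Lemma ev2VV p u v : ev2 f p u%:V v%:V = subst (fun=> p) (f u v).
Proof.
by rewrite ev2V1 /ev1 extV //; exact: morphD0 (klinearD (evr_klinear p u)).
Qed.

Lemma ev2Zl p q x y :
  ev2 f p (q *: x) y = csub (- p) (fun i : 'I_n => lvar i) q *: ev2 f p x y.
Proof. exact: (ext_semilinear (evl_klinear p y) (evlX p y)). Qed.

Lemma ev2Zr p q x y :
  ev2 f p x (q *: y) =
  csub (partial + p) (fun i : 'I_n => lvar i) q *: ev2 f p x y.
Proof.
rewrite /ev2 -ext_fZ; apply: eq_ext => u.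
exact: (ext_semilinear (evr_klinear p u) (evrX p u)).
Qed.

Lemma semilin_ev2l p y :
  semilin (- p) (fun i : 'I_n => lvar i) (fun x => ev2 f p x y).
Proof. by split=> [|q x]; [exact: ev2Dl | exact: ev2Zl]. Qed.

Lemma semilin_ev2r p x :
  semilin (partial + p) (fun i : 'I_n => lvar i) (ev2 f p x).
Proof. by split=> [|q y]; [exact: ev2Dr | exact: ev2Zr]. Qed.

Lemma ev20l p y : ev2 f p 0 y = 0.
Proof. exact: (morphD0 (ev2Dl p y)). Qed.

Lemma ev20r p x : ev2 f p x 0 = 0.
Proof. exact: (morphD0 (ev2Dr p x)). Qed.

End Evaluation.

End PolynomialsWithCoefficients.

(** * Products of cochains of low degree *)

Lemma sum_S0 (V : nmodType) (P : pred 'S_0) (F : 'S_0 -> V) :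
  P 1%g -> \sum_(s | P s) F s = F 1%g.
Proof.
move=> P1; rewrite (big_pred1 1%g) // => s.
have -> : s = 1%g by apply/permP => -[].
by rewrite P1 /= eqxx.
Qed.

Lemma sum_S1 (V : nmodType) (P : pred 'S_1) (F : 'S_1 -> V) :
  P 1%g -> \sum_(s | P s) F s = F 1%g.
Proof.
move=> P1; rewrite (big_pred1 1%g) // => s.
have -> : s = 1%g by apply/permP => i; rewrite !ord1.
by rewrite P1 /= eqxx.
Qed.

Definition swap2 : 'S_2 := tperm ord0 ord_max.

Lemma S2_cases (s : 'S_2) : s = 1%g \/ s = swap2.
Proof.
have H (i : 'I_2) : i = ord0 \/ i = ord_max.
  by case: i => [[|[|i]] ilt] //; [left | right]; apply: val_inj.
case: (H (s ord0)) => s0; [left | right]; apply/permP => i.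
  rewrite perm1; case: (H i) => -> //.
  case: (H (s ord_max)) => // s1; have /perm_inj // : s ord0 = s ord_max.
  by rewrite s0 s1.
case: (H i) => ->; first by rewrite tpermL.
rewrite tpermR; case: (H (s ord_max)) => // s1.
have /perm_inj // : s ord0 = s ord_max by rewrite s0 s1.
Qed.

Lemma sum_S2 (V : nmodType) (P : pred 'S_2) (F : 'S_2 -> V) :
  P 1%g -> P swap2 -> \sum_(s | P s) F s = F 1%g + F swap2.
Proof.
move=> P1 P2.
have d : swap2 != 1%g.
  by apply/eqP => /permP /(_ ord0); rewrite tpermL perm1.
rewrite (bigD1 1%g) //= (bigD1 swap2) ?P2 //= big_pred0 ?addr0 // => s.
by case: (S2_cases s) => ->; rewrite eqxx ?andbF.
Qed.

Lemma permn1 N j : permn (1 : 'S_N) j = j.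
Proof. by rewrite /permn; case: insubP => // i _ <-; rewrite perm1. Qed.

Lemma permn_swap0 : permn swap2 0 = 1.
Proof.
rewrite /permn (insubT (fun x => x < 2)%N (erefl : 0 < 2)%N) /=.
by rewrite [Sub _ _](_ : _ = ord0) ?tpermL //; apply: val_inj.
Qed.

Lemma permn_swap1 : permn swap2 1 = 0.
Proof.
rewrite /permn (insubT (fun x => x < 2)%N (erefl : 1 < 2)%N) /=.
by rewrite [Sub _ _](_ : _ = ord_max) ?tpermR //; apply: val_inj.
Qed.

(** Index 2 lies outside 'S_2: a shuffle never moves the last argument. *)
Lemma permn_swap2 : permn swap2 2 = 2.
Proof. by rewrite /permn insubF. Qed.

Section Cochains.
Variables (K : fieldType) (E : lmodType {poly K}).

(** One summand of [circ], without its signs. The permutation enters only as a function on indices,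
    so that its finitely many values can be rewritten one by one. *)
Definition circ_term p m n k (g : cochain E m) (t : cochain E n)
    (a : {ffun 'I_p.+1 -> E}) (pi : nat -> nat) : vpoly p E :=
  let arg j := a (inord (pi j)) in
  let var j := lvar (pi j) : cpoly K p in
  ext (fun e => subst
         (fun j : 'I_m =>
            if (j < k)%N then var j
            else if j == k :> nat then \sum_(i < n.+1) var (k + i)%N
            else var (j + n)%N)
         (g [ffun j : 'I_m.+1 =>
               if (j < k)%N then arg j
               else if j == k :> nat then e
               else arg (j + n)%N]))
      (subst (fun j : 'I_n => var (k + j)%N)
         (t [ffun j : 'I_n.+1 => arg (k + j)%N])).

Lemma circ_termE p m n (g : cochain E m) (t : cochain E n)
    (a : {ffun 'I_p.+1 -> E}) :
  circ g t a = \sum_(k < m.+1) (-1) ^+ (k * n) *: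
    \sum_(s : 'S_(k + n) | shuffle s)
      (-1) ^+ odd_perm s *: circ_term k g t a (permn s).
Proof. by []. Qed.

Definition binary (G : E -> E -> vpoly 1 E) : cochain E 1 :=
  fun a => G (a ord0) (a ord_max).

Definition unary (A : E -> E) : cochain E 0 := fun a => (A (a ord0))%:V.

Lemma shuffle1 k n : shuffle (1 : 'S_(k + n)).
Proof.
apply/forallP => i; apply/forallP => j; rewrite !perm1; apply/implyP.
by case/orP => [/andP[] | /andP[]].
Qed.

Lemma shuffle_swap : @shuffle 1 1 swap2.
Proof.
apply/forallP => -[[|[|i]] ilt] //; apply/forallP => -[[|[|j]] jlt] //.
Qed.

Section Terms.
Variables (g t : cochain E 1) (G T : E -> E -> vpoly 1 E).
Hypotheses (gE : g =1 binary G) (tE : t =1 binary T).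
Hypotheses (Gbil : conformal_bilinear G) (Tbil : conformal_bilinear T).

Lemma circ_term0 (a : {ffun 'I_3 -> E}) pi :
  circ_term 0 g t a pi =
  ev2 G (lvar (pi 0) + lvar (pi 1))
    (ev2 T (lvar (pi 0)) (a (inord (pi 0)))%:V (a (inord (pi 1)))%:V)
    (a (inord (pi 2)))%:V.
Proof.
rewrite /circ_term tE /binary !ffunE /=.
have XE : subst (fun j : 'I_1 => lvar (pi (0 + j)%N))
    (T (a (inord (pi (0 + 0)%N))) (a (inord (pi (0 + 1)%N)))) =
    ev2 T (lvar (pi 0)) (a (inord (pi 0)))%:V (a (inord (pi 1)))%:V :> vpoly 2 E.
  by rewrite (ev2VV Tbil); apply: eq_subst => i; rewrite ord1.
apply: (etrans (congr1 _ XE)); apply: eq_ext => e.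
rewrite gE /binary !ffunE /= -(ev2V1 Gbil) (ev2VV Gbil).
apply: eq_subst => i; rewrite ord1 /=.
by rewrite big_ord_recl big_ord1.
Qed.

Lemma circ_term1 (a : {ffun 'I_3 -> E}) pi :
  circ_term 1 g t a pi =
  ev2 G (lvar (pi 0)) (a (inord (pi 0)))%:V
    (ev2 T (lvar (pi 1)) (a (inord (pi 1)))%:V (a (inord (pi 2)))%:V).
Proof.
rewrite /circ_term tE /binary !ffunE /=.
have XE : subst (fun j : 'I_1 => lvar (pi (1 + j)%N))
    (T (a (inord (pi (1 + 0)%N))) (a (inord (pi (1 + 1)%N)))) =
    ev2 T (lvar (pi 1)) (a (inord (pi 1)))%:V (a (inord (pi 2)))%:V :> vpoly 2 E.
  by rewrite (ev2VV Tbil); apply: eq_subst => i; rewrite ord1.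
apply: (etrans (congr1 _ XE)); rewrite (ev2V1 Gbil).
apply: eq_ext => e; rewrite gE /binary !ffunE /=.
by apply: eq_subst => i; rewrite ord1.
Qed.

Lemma circ11 (a : {ffun 'I_3 -> E}) :
  let x := (a (inord 0))%:V in let y := (a (inord 1))%:V in
  let z := (a (inord 2))%:V in
  circ g t a = ev2 G (lam + mu) (ev2 T lam x y) z
    - (ev2 G lam x (ev2 T mu y z) - ev2 G mu y (ev2 T lam x z)).
Proof.
rewrite circ_termE big_ord_recl big_ord1 [val ord0]/= expr0 scale1r expr1 scaleN1r.
congr (_ - _).
- apply: etrans; first by apply: sum_S1; exact: shuffle1.
  by rewrite odd_perm1 scale1r circ_term0 !permn1.
- apply: etrans; first apply: sum_S2; [exact: shuffle1 | exact: shuffle_swap |].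
  congr (_ + _).
    by rewrite odd_perm1 scale1r [LHS]circ_term1 !permn1.
  rewrite odd_tperm [in LHS]/= expr1 scaleN1r [X in - X = _]circ_term1.
  by rewrite permn_swap0 permn_swap1 permn_swap2.
Qed.

End Terms.

Section Unary.
Variables (g : cochain E 1) (G : E -> E -> vpoly 1 E).
Variables (t : cochain E 0) (A : {linear E -> E}).
Hypotheses (gE : g =1 binary G) (tE : t =1 unary A).
Hypotheses (G0l : forall x, G 0 x = 0) (G0r : forall x, G x 0 = 0).

Lemma subst1 V (s : 'I_1 -> cpoly K 1) (x : vpoly 1 V) :
  s ord0 = lam -> subst s x = x.
Proof.
by move=> sE; rewrite -[RHS]substK; apply: eq_subst => i; rewrite ord1 sE.
Qed.

(** A cochain of degree zero has no formal variable, so inserting it in either slot changes neither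
    subscript nor sign. *)
Lemma circ10 (a : {ffun 'I_2 -> E}) :
  circ g t a = G (A (a ord0)) (a ord_max) + G (a ord0) (A (a ord_max)).
Proof.
have i0 : inord 0 = ord0 :> 'I_2 by apply: val_inj; rewrite /= inordK.
have i1 : inord 1 = ord_max :> 'I_2 by apply: val_inj; rewrite /= inordK.
rewrite circ_termE big_ord_recl big_ord1 !muln0 !expr0 !scale1r.
congr (_ + _).
- apply: etrans; first by apply: sum_S0; exact: shuffle1.
  rewrite odd_perm1 scale1r /circ_term tE /unary !ffunE /= [X in ext _ X]substV.
  rewrite !permn1 i0 extV; last by rewrite gE /binary !ffunE /= G0l subst0.
  rewrite gE /binary !ffunE /= permn1 i1 subst1 //=.
  by rewrite big_ord1 permn1.
- apply: etrans; first by apply: sum_S1; exact: shuffle1.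
  rewrite odd_perm1 scale1r /circ_term tE /unary !ffunE /= [X in ext _ X]substV.
  rewrite !permn1 i1 extV; last by rewrite gE /binary !ffunE /= G0r subst0.
  rewrite gE /binary !ffunE /= permn1 i0 subst1 //=.
  by rewrite permn1.
Qed.

Lemma circ01 (a : {ffun 'I_2 -> E}) :
  circ t g a = vmap A (G (a ord0) (a ord_max)).
Proof.
have i0 : inord 0 = ord0 :> 'I_2 by apply: val_inj; rewrite /= inordK.
have i1 : inord 1 = ord_max :> 'I_2 by apply: val_inj; rewrite /= inordK.
rewrite circ_termE big_ord1 mul0n expr0 scale1r.
apply: etrans; first by apply: sum_S1; exact: shuffle1.
rewrite odd_perm1 scale1r /circ_term gE /binary !ffunE /= !permn1 i0 i1.
rewrite [X in ext _ X]subst1 /= ?permn1 //.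
by apply: eq_ext => e; rewrite tE /unary !ffunE /= substV.
Qed.

End Unary.

End Cochains.

(** * Changes of variables in nested brackets *)

Section TwoVariables.
Variables (K : fieldType).
Implicit Types U V W X : lmodType {poly K}.
Implicit Types (p q : cpoly K 2).

Definition sub2 p q : 'I_2 -> cpoly K 2 :=
  fun i => if i == 0 :> nat then p else q.

Lemma csub_lam t (s : 'I_2 -> cpoly K 2) : csub t s lam = s ord0.
Proof. exact: (csub_var t s ord0). Qed.

Lemma csub_mu t (s : 'I_2 -> cpoly K 2) : csub t s mu = s ord_max.
Proof. exact: (csub_var t s ord_max). Qed.

Section Nested.
Variables (U V W X Y : lmodType {poly K}).

(** Both sides are semilinear in the value g u v. The two equations on subscripts say that their
    ring morphisms agree on 'X and on the single variable of that value; q is compared only after 'X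
    has become - p. *)
Lemma subst_ev2_l (f : X -> W -> vpoly 1 Y) (g : U -> V -> vpoly 1 X)
    (s : 'I_2 -> cpoly K 2) p q p' q' u v w :
  conformal_bilinear f -> conformal_bilinear g ->
  csub partial s p = p' ->
  csub partial s (csub (- p) (fun i : 'I_2 => lvar i) q) =
    csub (- p') (fun i : 'I_2 => lvar i) q' ->
  subst s (ev2 f p (ev2 g q u%:V v%:V) w%:V) =
  ev2 f p' (ev2 g q' u%:V v%:V) w%:V.
Proof.
move=> fb gb pE qE; rewrite [ev2 g q _ _](ev2VV gb) [ev2 g q' _ _](ev2VV gb).
move: (g u v); apply: (semilin_ext
  (semilin_comp (semilin_subst X (fun=> q))
    (semilin_comp (semilin_ev2l fb p w%:V) (semilin_subst Y s)))
  (semilin_comp (semilin_subst X (fun=> q')) (semilin_ev2l fb p' w%:V)))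
  => [|_|x].
- by rewrite !csubX [in LHS]rmorphN /= pE.
- by rewrite -csub_comp.
- rewrite [subst (fun=> q) _]substV [subst (fun=> q') _]substV.
  by rewrite (ev2VV fb) subst_comp [RHS](ev2VV fb); apply: eq_subst => _.
Qed.

Lemma subst_ev2_r (f : W -> X -> vpoly 1 Y) (g : U -> V -> vpoly 1 X)
    (s : 'I_2 -> cpoly K 2) p q p' q' u v w :
  conformal_bilinear f -> conformal_bilinear g ->
  csub partial s p = p' ->
  csub partial s (csub (partial + p) (fun i : 'I_2 => lvar i) q) =
    csub (partial + p') (fun i : 'I_2 => lvar i) q' ->
  subst s (ev2 f p w%:V (ev2 g q u%:V v%:V)) =
  ev2 f p' w%:V (ev2 g q' u%:V v%:V).
Proof.
move=> fb gb pE qE; rewrite [ev2 g q _ _](ev2VV gb) [ev2 g q' _ _](ev2VV gb).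
move: (g u v); apply: (semilin_ext
  (semilin_comp (semilin_subst X (fun=> q))
    (semilin_comp (semilin_ev2r fb p w%:V) (semilin_subst Y s)))
  (semilin_comp (semilin_subst X (fun=> q')) (semilin_ev2r fb p' w%:V)))
  => [|_|x].
- by rewrite !csubX [in LHS]rmorphD /= csubX pE.
- by rewrite -csub_comp.
- rewrite [subst (fun=> q) _]substV [subst (fun=> q') _]substV.
  by rewrite (ev2VV fb) subst_comp [RHS](ev2VV fb); apply: eq_subst => _.
Qed.

End Nested.

Lemma csub_opp3 t p q :
  csub t (sub2 p q) (- partial - lam - mu) = - t - p - q.
Proof. by rewrite !rmorphB rmorphN /= csubX csub_lam csub_mu. Qed.

Lemma csub_opplam t (s : 'I_2 -> cpoly K 2) :
  csub t s (- partial - lam) = - t - s ord0.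
Proof. by rewrite rmorphB rmorphN /= csubX csub_lam. Qed.

Lemma csub_oppmu t (s : 'I_2 -> cpoly K 2) :
  csub t s (- partial - mu) = - t - s ord_max.
Proof. by rewrite rmorphB rmorphN /= csubX csub_mu. Qed.

Lemma csub_lammu t p q : csub t (sub2 p q) (lam + mu) = p + q.
Proof. by rewrite rmorphD /= csub_lam csub_mu. Qed.

Lemma csub2_lam t t' p q :
  csub t (sub2 p q) (csub t' (fun i : 'I_2 => lvar i) lam) = p.
Proof. by rewrite [csub t' _ _]csub_lam [LHS]csub_lam. Qed.

Lemma csub2_mu t t' p q :
  csub t (sub2 p q) (csub t' (fun i : 'I_2 => lvar i) mu) = q.
Proof. by rewrite [csub t' _ _]csub_mu [LHS]csub_mu. Qed.

End TwoVariables.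

(** * Sums, compositions and flips of conformal bilinear maps *)

Section BilinearConstructions.
Variables (K : fieldType).
Implicit Types U V W X : lmodType {poly K}.

Lemma klinear_add n V W (f g : V -> vpoly n W) :
  klinear f -> klinear g -> klinear (fun v => f v + g v).
Proof. by move=> fl gl c u v; rewrite fl gl addrACA scalerDr. Qed.

Lemma cbil_add U V W (f g : U -> V -> vpoly 1 W) :
  conformal_bilinear f -> conformal_bilinear g ->
  conformal_bilinear (fun u v => f u v + g u v).
Proof.
move=> [fl fr fXl fXr] [gl gr gXl gXr]; split=> [v|u|u v|u v].
- exact: klinear_add.
- exact: klinear_add.
- by rewrite fXl gXl scalerDr.
- by rewrite fXr gXr scalerDr.
Qed.

Lemma cbil_vmap U V W X (f : U -> V -> vpoly 1 W) (g : {linear W -> X}) :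
  conformal_bilinear f -> conformal_bilinear (fun u v => vmap g (f u v)).
Proof.
move=> [fl fr fXl fXr]; split=> [v c u u'|u c v v'|u v|u v].
- by rewrite fl vmapD vmapZ.
- by rewrite fr vmapD vmapZ.
- by rewrite fXl vmapZ.
- by rewrite fXr vmapZ.
Qed.

Lemma cbil_comp U V U' V' W (f : U' -> V' -> vpoly 1 W)
    (A : {linear U -> U'}) (B : {linear V -> V'}) :
  conformal_bilinear f -> conformal_bilinear (fun u v => f (A u) (B v)).
Proof.
move=> [fl fr fXl fXr]; split=> [v c u u'|u c v v'|u v|u v].
- by rewrite linearP fl.
- by rewrite linearP fr.
- by rewrite linearZ fXl.
- by rewrite linearZ fXr.
Qed.

(** The term r(b)_(- d - l) u of c, as a map of u and b in the order in which c takes them. *)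
Definition flip U V W (f : U -> V -> vpoly 1 W) (v : V) (u : U) : vpoly 1 W :=
  ev2 f (- partial - lam) u%:V v%:V.

(** At p = - d - l the factors d + p and - p are - l and d + l, so the two sesquilinearity rules
    trade places. *)
Lemma cbil_flip U V W (f : U -> V -> vpoly 1 W) :
  conformal_bilinear f -> conformal_bilinear (flip f).
Proof.
move=> fb; split=> [u c v v'|v c u u'|v u|v u]; rewrite /flip.
- by rewrite vconstD vconstZ (ev2Dr fb) (ev2Zr fb) csubC.
- by rewrite vconstD vconstZ (ev2Dl fb) (ev2Zl fb) csubC.
- by rewrite vconstX (ev2Zr fb) csubX addrA addrN add0r.
- by rewrite vconstX (ev2Zl fb) csubX opprB opprK addrC.
Qed.

Lemma ev2_flip n U V W (f : U -> V -> vpoly 1 W) (p : cpoly K n) x y :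
  conformal_bilinear f -> ev2 (flip f) p x y = ev2 f (- partial - p) y x.
Proof.
move=> fb; have gb := cbil_flip fb; move: x.
apply: (semilin_ext (semilin_ev2l gb p y) (semilin_ev2r fb _ y)) => [|//|v].
  by rewrite addrA addrN add0r.
move: y; apply: (semilin_ext (semilin_ev2r gb p v%:V) (semilin_ev2l fb _ v%:V))
  => [|//|u]; first by rewrite opprB opprK addrC.
rewrite (ev2VV gb) (ev2VV fb) /flip (ev2VV fb) subst_comp.
by apply: eq_subst => _; rewrite rmorphB rmorphN /= csubX (csub_var _ _ ord0).
Qed.

Lemma ev2_add n U V W (f g : U -> V -> vpoly 1 W) (p : cpoly K n) x y :
  conformal_bilinear f -> conformal_bilinear g ->
  ev2 (fun u v => f u v + g u v) p x y = ev2 f p x y + ev2 g p x y.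
Proof.
move=> fb gb; rewrite /ev2 -ext_fD; apply: eq_ext => u.
by rewrite /ev1 -ext_fD; apply: eq_ext => v; rewrite substD.
Qed.

Lemma ev2_vmap n U V W X (f : U -> V -> vpoly 1 W) (g : {linear W -> X})
    (p : cpoly K n) x y : conformal_bilinear f ->
  ev2 (fun u v => vmap g (f u v)) p x y = vmap g (ev2 f p x y).
Proof.
move=> fb; have gb := cbil_vmap g fb; move: x.
apply: (semilin_ext (semilin_ev2l gb p y)
  (semilin_comp (semilin_ev2l fb p y) (semilin_vmap g n))) => [|i|u].
- by rewrite csub_id.
- by rewrite csub_id.
move: y; apply: (semilin_ext (semilin_ev2r gb p u%:V)
  (semilin_comp (semilin_ev2r fb p u%:V) (semilin_vmap g n))) => [|i|v].
- by rewrite csub_id.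
- by rewrite csub_id.
by rewrite (ev2VV gb) (ev2VV fb) subst_vmap.
Qed.

Lemma ev2_comp n U V U' V' W (f : U' -> V' -> vpoly 1 W)
    (A : {linear U -> U'}) (B : {linear V -> V'}) (p : cpoly K n) x y :
  conformal_bilinear f ->
  ev2 (fun u v => f (A u) (B v)) p x y = ev2 f p (vmap A x) (vmap B y).
Proof.
move=> fb; have gb := cbil_comp A B fb; move: x.
apply: (semilin_ext (semilin_ev2l gb p y)
  (semilin_comp (semilin_vmap A n) (semilin_ev2l fb p (vmap B y)))) => [|i|u].
- by rewrite csubX.
- by rewrite csub_var.
rewrite vmapV.
move: y; apply: (semilin_ext (semilin_ev2r gb p u%:V)
  (semilin_comp (semilin_vmap B n) (semilin_ev2r fb p (A u)%:V))) => [|i|v].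
- by rewrite csubX.
- by rewrite csub_var.
by rewrite vmapV (ev2VV gb) (ev2VV fb).
Qed.

End BilinearConstructions.

Section Combinations.
Variables (Z : zmodType).
Implicit Types A B C D F G : Z.

(** These four rearrangements close the identities with the same suffix. The primed letters are the
    terms after the change of variables. *)
Lemma combine_HRH A B C D : C = B + A -> B + D = 0 -> A = D + C.
Proof. by move=> -> BD; rewrite addrA [D + B]addrC BD add0r. Qed.

Lemma combine_HHR A B C D F : A = B - C -> B = D -> C = F -> D = A + F.
Proof. by move=> -> -> ->; rewrite subrK. Qed.

Lemma combine_RHR A B C D A' B' C' D' : A - B - C = D ->
  A = A' -> B = B' -> C = C' -> D = D' -> A' = B' + D' + C'.
Proof. by move=> <- <- <- <- <-; rewrite -addrA subrK addrC subrK. Qed.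

Lemma combine_HRR A B C D A' B' C' D' F G F' :
  A - B - C = D -> F + G = 0 ->
  A = A' -> B = B' -> C = C' -> D = D' -> F = F' -> G = B' -> D' + C' = F' + A'.
Proof.
move=> <- FG <- <- <- <- <- GB; rewrite GB in FG.
by rewrite subrK addrC; congr (_ + _); apply: esym; apply/eqP; rewrite -addr_eq0 FG.
Qed.

End Combinations.

Section LinearForms.
Variables (A : comNzRingType) (d x y : A).

(** Here - d - x - y acts as a third subscript: the three sum to - d, so each is determined by the
    other two. The last four rules also account for the reading of 'X inside a nested term. *)
Lemma cancel_lam : - d - (- d - x - y) - x = y.
Proof. by ring. Qed.

Lemma cancel_mu : - d - x - (- d - x - y) = y.
Proof. by ring. Qed.

Lemma cancel_mu' : - d - y - (- d - x - y) = x.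
Proof. by ring. Qed.

Lemma lam_opp : x + (- d - x - y) = - d - y.
Proof. by ring. Qed.

Lemma mu_opp : y + (- d - x - y) = - d - x.
Proof. by ring. Qed.

Lemma opp_lam : - (d + x) - y = - d - x - y.
Proof. by ring. Qed.

Lemma opp_mu : - (d + y) - x = - d - x - y.
Proof. by ring. Qed.

Lemma opp_lammu : - - (x + y) - x = y.
Proof. by ring. Qed.

Lemma opp_opp3 : - (d + (- d - x - y)) - x = y.
Proof. by ring. Qed.

End LinearForms.

(** * The cocycle axioms in the variables of the Maurer-Cartan equation *)

Section Identities.
Variables (K : fieldType) (R H : leibnizConformalAlgebra K) (z : Z2nab R H).

Local Notation br := (ev2 (@bracket K H)).
Local Notation brR := (ev2 (@bracket K R)).
Local Notation l := (ev2 (zl z)).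
Local Notation r := (ev2 (zr z)).
Local Notation chi := (ev2 (zchi z)).

Lemma zl_bilinear : conformal_bilinear (zl z).
Proof.
have [la lX] := zl_hom z.
split=> // [a|a v]; have [[dl dX] _] := zl_cder z a; [exact: dl | exact: dX].
Qed.

Lemma zr_bilinear : conformal_bilinear (zr z).
Proof.
have [la lX] := zr_hom z.
split=> // [a|a v]; have [[dl dX] _] := zr_cder z a; [exact: dl | exact: dX].
Qed.

Let lb := zl_bilinear.
Let rb := zr_bilinear.
Let cb := zchi_bilinear z.
Let hb := bracket_bilinear H.
Let Rb := bracket_bilinear R.

Implicit Types (a b c : R) (u v w : H).

(** The suffix tells in which summand each of the three arguments lies. This pattern is the rule for
    [cderL]. *)
Lemma identity_RHH a v w :
  l lam a%:V (br mu v%:V w%:V) =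
  br (lam + mu) (l lam a%:V v%:V) w%:V + br mu v%:V (l lam a%:V w%:V)
  :> vpoly 2 H.
Proof.
have [_ e] := zl_cder z a; apply: (etrans (ev2V1 lb _ _ _)).
apply: (etrans (e v w)); apply: (etrans (addrC _ _)).
apply: (congr2 (fun A B => br (lam + mu) A w%:V + br mu v%:V B)); apply: esym.
  exact: (ev2V1 lb).
exact: (ev2V1 lb).
Qed.


(** Exchange the two variables in the previous identity; the first half of (i) then replaces l(b) u
    by - r(b) u inside the bracket. *)
Lemma identity_HRH u b w :
  br lam u%:V (l mu b%:V w%:V) =
  br (lam + mu) (r (- partial - lam) b%:V u%:V) w%:V
  + l mu b%:V (br lam u%:V w%:V) :> vpoly 2 H.
Proof.
have e1 := congr1 (subst (sub2 mu lam)) (identity_RHH b u w).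
have {e1}e1 : l mu b%:V (br lam u%:V w%:V) =
  br (lam + mu) (l mu b%:V u%:V) w%:V + br lam u%:V (l mu b%:V w%:V)
  :> vpoly 2 H.
  apply: etrans; last apply: (etrans e1).
  - apply: esym; apply: (subst_ev2_r _ _ _ lb hb); first by rewrite csub_lam.
    by rewrite csub2_mu csub_lam.
  - apply: (etrans (substD _ _ _)); congr (_ + _).
    + apply: (subst_ev2_l _ _ _ hb lb); first by rewrite csub_lammu addrC.
      by rewrite csub2_lam csub_mu.
    + apply: (subst_ev2_r _ _ _ hb lb); first by rewrite csub_mu.
      by rewrite csub2_lam csub_mu.
have e2 := congr1 (subst (sub2 mu lam)) (cocycle_brl z b u w).
have {e2}e2 : br (lam + mu) (l mu b%:V u%:V) w%:V +
   br (lam + mu) (r (- partial - lam) b%:V u%:V) w%:V = 0 :> vpoly 2 H.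
  apply: etrans; last apply: (etrans e2); last exact: subst0.
  rewrite (ev2Dl hb); apply: esym; apply: (etrans (substD _ _ _)); congr (_ + _).
  + apply: (subst_ev2_l _ _ _ hb lb); first by rewrite csub_lammu addrC.
    by rewrite csub2_lam csub_mu.
  (* In the left argument of a bracket with subscript l + m, 'X is read as - (l + m), so - d - l and
     m coincide. *)
  + apply: (subst_ev2_l _ _ _ hb rb); first by rewrite csub_lammu addrC.
    by rewrite csub2_lam csub_opplam opp_lammu.
exact: combine_HRH e1 e2.
Qed.

(** The rule for [cderR] after the simultaneous substitution l := - d - l - m, m := l, which makes c
    the last argument. *)
Lemma identity_HHR u v c :
  br lam u%:V (r (- partial - mu) c%:V v%:V) =
  r (- partial - lam - mu) c%:V (br lam u%:V v%:V)
  + br mu v%:V (r (- partial - lam) c%:V u%:V) :> vpoly 2 H.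
Proof.
pose s := sub2 (- partial - lam - mu) (lam : cpoly K 2).
have [_ e] := zr_cder z c.
have {e}e : r lam c%:V (br mu u%:V v%:V) =
    br mu u%:V (r lam c%:V v%:V)
    - br (- partial - lam - mu) v%:V (r lam c%:V u%:V) :> vpoly 2 H.
  apply: (etrans (ev2V1 rb _ _ _)); apply: (etrans (e u v)).
  apply: (congr2 (fun A B => br mu u%:V A - br (- partial - lam - mu) v%:V B));
    apply: esym; exact: (ev2V1 rb).
have {e}e := congr1 (subst s) e.
have e1 : subst s (r lam c%:V (br mu u%:V v%:V)) =
  r (- partial - lam - mu) c%:V (br lam u%:V v%:V).
  apply: (subst_ev2_r _ _ _ rb hb); first by rewrite csub_lam.
  by rewrite csub2_mu csub_lam.
have e2 : subst s (br mu u%:V (r lam c%:V v%:V)) =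
  br lam u%:V (r (- partial - mu) c%:V v%:V).
  apply: (subst_ev2_r _ _ _ hb rb); first by rewrite csub_mu.
  by rewrite csub2_lam csub_oppmu opp_lam.
have e3 : subst s (br (- partial - lam - mu) v%:V (r lam c%:V u%:V)) =
  br mu v%:V (r (- partial - lam) c%:V u%:V).
  apply: (subst_ev2_r _ _ _ hb rb); first by rewrite csub_opp3 cancel_lam.
  by rewrite csub2_lam csub_opplam opp_mu.
have {e}e := etrans (esym e1) (etrans e (substB _ _ _)).
exact: combine_HHR e e2 e3.
Qed.

(** Axiom (iii) with m replaced by the third subscript - d - l - m. *)
Lemma identity_RHR a v c :
  l lam a%:V (r (- partial - mu) c%:V v%:V) =
  r (- partial - lam - mu) c%:V (l lam a%:V v%:V)
  + br mu v%:V (chi lam a%:V c%:V)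
  + r (- partial - mu) (brR lam a%:V c%:V) v%:V :> vpoly 2 H.
Proof.
pose s := sub2 lam (- partial - lam - mu : cpoly K 2).
have e := congr1 (subst s) (cocycle_lr z a c v).
have {}e := etrans (esym (etrans (substB _ _ _)
  (congr2 (fun A B => A - B) (substB _ _ _) (erefl _)))) e.
apply: (combine_RHR e).
- apply: (subst_ev2_r _ _ _ lb rb); first by rewrite csub_lam.
  by rewrite csub2_mu csub_oppmu opp_lam.
- apply: (subst_ev2_r _ _ _ rb lb); first by rewrite csub_mu.
  by rewrite csub2_lam csub_lam.
- apply: (subst_ev2_l _ _ _ rb Rb); first by rewrite csub_lammu lam_opp.
  by rewrite csub2_lam csub_lam.
- apply: (subst_ev2_r _ _ _ hb cb); first by rewrite csub_opp3 cancel_mu.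
  by rewrite csub2_lam csub_lam.
Qed.

(** Axiom (iii) for b, c produces - r(c) l(b) u; the second half of (i) turns it into r(c) r(b)
    u. *)
Lemma identity_HRR u b c :
  br lam u%:V (chi mu b%:V c%:V) + r (- partial - lam) (brR mu b%:V c%:V) u%:V =
  r (- partial - lam - mu) c%:V (r (- partial - lam) b%:V u%:V)
  + l mu b%:V (r (- partial - lam) c%:V u%:V) :> vpoly 2 H.
Proof.
pose s := sub2 mu (- partial - lam - mu : cpoly K 2).
have e := congr1 (subst s) (cocycle_lr z b c u).
have {}e := etrans (esym (etrans (substB _ _ _)
  (congr2 (fun A B => A - B) (substB _ _ _) (erefl _)))) e.
(* In (i) the outer map is r(c), so its subscript l becomes the third one, and b keeps m. *)
pose s' := sub2 (- partial - lam - mu) (mu : cpoly K 2).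
have e' := congr1 (subst s') (etrans (esym (ev2Dr rb _ _ _ _)) (cocycle_rr z c b u)).
have {}e' := etrans (esym (substD _ _ _)) (etrans e' (subst0 _ _)).
apply: (combine_HRR (B' := r (- partial - lam - mu) c%:V (l mu b%:V u%:V)) e e').
- apply: (subst_ev2_r _ _ _ lb rb); first by rewrite csub_lam.
  by rewrite csub2_mu csub_opplam opp_mu.
- apply: (subst_ev2_r _ _ _ rb lb); first by rewrite csub_mu.
  by rewrite csub2_lam csub_mu.
- apply: (subst_ev2_l _ _ _ rb Rb); first by rewrite csub_lammu mu_opp.
  by rewrite csub2_lam csub_mu.
- apply: (subst_ev2_r _ _ _ hb cb); first by rewrite csub_opp3 cancel_mu'.
  by rewrite csub2_lam csub_mu.
- apply: (subst_ev2_r _ _ _ rb rb); first by rewrite csub_lam.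
  by rewrite csub2_mu csub_opplam opp_opp3.
- apply: (subst_ev2_r _ _ _ rb lb); first by rewrite csub_lam.
  by rewrite csub2_mu csub_mu.
Qed.

End Identities.

(** * The Maurer-Cartan equation *)

Section MCCombination.
Variables (Z : zmodType).

(** By [circ11] each of the products pi.c, c.pi and c.c has the form P - (Q - S). *)
Lemma sum_three_sub (P1 P2 P3 Q1 Q2 Q3 S1 S2 S3 : Z) :
  P1 + P2 + P3 + (S1 + S2 + S3) = Q1 + Q2 + Q3 ->
  P1 - (Q1 - S1) + (P2 - (Q2 - S2)) + (P3 - (Q3 - S3)) = 0.
Proof.
move=> e; rewrite !opprB !addrA.
rewrite (ACl ((1*4*7)*(2*5*8)*(3*6*9)))%AC /= e.
by rewrite -!opprD subrr.
Qed.

(* The terms of x.(y.z), (x.y).z and y.(x.z) for x.y = pi + c are named L_i, M_i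
   and N_i; L_1, M_1, N_1 would be those of the bracket of H alone. *)
Lemma combine_MC (L2 L3 L4 L5 L6 L7 L8 L9 L10 M2 M3 M4 M5 M6 M7 M8 M9 M10
    N2 N3 N4 N5 N6 N7 N8 N9 N10 : Z) :
  L5 = M2 + N2 -> L2 = M3 + N5 -> L3 = M5 + N3 -> L6 - N6 - M9 = M4 ->
  L7 = M6 + N4 + N9 -> L4 + L9 = M7 + N7 ->
  L10 - N10 - M10 + L8 - N8 - M8 = 0 ->
  M2 + M3 + M4 - (L2 + L3 + L4 - (N2 + N3 + N4))
  + (M9 + M5 + M10 - (L5 + L9 + L10 - (N5 + N9 + N10)))
  + (M6 + M7 + M8 - (L6 + L7 + L8 - (N6 + N7 + N8))) = 0.
Proof.
move=> e1 e2 e3 e4 e5 e6 e7; apply: sum_three_sub.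
have e4' : L6 = M4 + M9 + N6 by rewrite -e4 !subrK.
have e7' : L10 + L8 = M8 + N8 + (M10 + N10).
  apply/eqP; rewrite -subr_eq0 -[X in _ == X]e7; apply/eqP.
  rewrite !opprD !addrA; exact: (ACl (1*6*5*2*4*3))%AC.
rewrite [RHS](_ : _ = L5 + L2 + L3 + L6 + L7 + (L4 + L9) + (L10 + L8)); last first.
  by rewrite !addrA (ACl (4*1*2*7*8*3*5*6*9))%AC.
rewrite e1 e2 e3 e4' e5 e6 e7' !addrA.
by rewrite (ACl (1*10*2*13*5*11*3*4*16*7*12*14*8*17*9*18*6*15))%AC.
Qed.

End MCCombination.

Section DirectSum.
Variables (K : fieldType) (R H : leibnizConformalAlgebra K).
Local Notation E := (dsum R H).

Definition prR (e : E) : R := e.1.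
Definition prH (e : E) : H := e.2.

Lemma inR_is_linear : linear (@inR K R H).
Proof. by move=> c u v; rewrite /inR -[RHS]/(_, _) /= scaler0 addr0. Qed.
Lemma inH_is_linear : linear (@inH K R H).
Proof. by move=> c u v; rewrite /inH -[RHS]/(_, _) /= scaler0 addr0. Qed.
Lemma prR_is_linear : linear prR. Proof. by []. Qed.
Lemma prH_is_linear : linear prH. Proof. by []. Qed.

HB.instance Definition _ :=
  GRing.isLinear.Build {poly K} R E *:%R (@inR K R H) inR_is_linear.
HB.instance Definition _ :=
  GRing.isLinear.Build {poly K} H E *:%R (@inH K R H) inH_is_linear.
HB.instance Definition _ :=
  GRing.isLinear.Build {poly K} E R *:%R prR prR_is_linear.
HB.instance Definition _ :=
  GRing.isLinear.Build {poly K} E H *:%R prH prH_is_linear.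

Local Notation iR := (@inR K R H).
Local Notation iH := (@inH K R H).

Lemma vmap_comp_coef n (U V W : lmodType {poly K}) (f : {linear U -> V})
    (g : {linear V -> W}) (x : vpoly n U) k :
  (vmap g (vmap f x))@_k = g (f (x@_k)).
Proof. exact: etrans (vmap_coef g _ k) (congr1 g (vmap_coef f x k)). Qed.

Lemma vmap_comp0 n (U V W : lmodType {poly K}) (f : {linear U -> V})
    (g : {linear V -> W}) (x : vpoly n U) :
  (forall u, g (f u) = 0) -> vmap g (vmap f x) = 0.
Proof.
move=> gf; apply/malgP => k; apply: etrans (vmap_comp_coef f g x k) _.
by rewrite gf mcoeff0.
Qed.

Lemma vmap_compK n (U V : lmodType {poly K}) (f : {linear U -> V})
    (g : {linear V -> U}) (x : vpoly n U) :
  cancel f g -> vmap g (vmap f x) = x.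
Proof.
move=> gf; apply/malgP => k; apply: etrans (vmap_comp_coef f g x k) _.
by rewrite gf.
Qed.

Lemma vmap_prH_inH n (x : vpoly n H) : vmap prH (vmap iH x) = x.
Proof. exact: vmap_compK. Qed.

Lemma vmap_prR_inH n (x : vpoly n H) : vmap prR (vmap iH x) = 0.
Proof. exact: vmap_comp0. Qed.

Lemma vmap_inH_inj n : injective (@vmap K n _ _ iH).
Proof. by move=> x y e; rewrite -(vmap_prH_inH x) e vmap_prH_inH. Qed.

Definition sum_bracket (a b : E) : vpoly 1 E :=
  vmap iR (bracket (prR a) (prR b)) + vmap iH (bracket (prH a) (prH b)).

Lemma sum_bracketE : @dsum_bracket K R H =1 binary sum_bracket.
Proof. by []. Qed.

Lemma sum_bracket_bilinear : conformal_bilinear sum_bracket.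
Proof.
apply: cbil_add; apply: cbil_vmap.
  exact: (cbil_comp prR prR (bracket_bilinear R)).
exact: (cbil_comp prH prH (bracket_bilinear H)).
Qed.

Lemma ev2_sum_bracket n (p : cpoly K n) x y :
  ev2 sum_bracket p x y =
  vmap iR (ev2 (@bracket K R) p (vmap prR x) (vmap prR y))
  + vmap iH (ev2 (@bracket K H) p (vmap prH x) (vmap prH y)).
Proof.
have bR := cbil_comp prR prR (bracket_bilinear R).
have bH := cbil_comp prH prH (bracket_bilinear H).
apply: (etrans (ev2_add p x y (cbil_vmap iR bR) (cbil_vmap iH bH))).
congr (_ + _).
  apply: (etrans (ev2_vmap iR p x y bR)).
  by rewrite (ev2_comp prR prR p x y (bracket_bilinear R)).
apply: (etrans (ev2_vmap iH p x y bH)).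
by rewrite (ev2_comp prH prH p x y (bracket_bilinear H)).
Qed.

Variable z : Z2nab R H.

Let lb := zl_bilinear z.
Let rb := cbil_flip (zr_bilinear z).
Let cb := zchi_bilinear z.

(** The component of c in C^{1,1}; [mc_chi] is the one in C^{2,0}. They are kept apart because
    [in_dgla] asks for this decomposition. *)
Definition mc_lr (a b : E) : vpoly 1 E :=
  vmap iH (zl z (prR a) (prH b)) + vmap iH (flip (zr z) (prH a) (prR b)).

Definition mc_chi (a b : E) : vpoly 1 E := vmap iH (zchi z (prR a) (prR b)).

Definition mc_map (a b : E) : vpoly 1 E := mc_lr a b + mc_chi a b.

Lemma mc_mapE : MC_of_cocycle z =1 binary mc_map.
Proof.
move=> a; rewrite /MC_of_cocycle /binary /mc_map /mc_lr /mc_chi.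
by case: (a ord0) => x u; case: (a ord_max) => y v; rewrite [LHS]vmapD vmapD.
Qed.

Lemma mc_lr_bilinear : conformal_bilinear mc_lr.
Proof.
apply: cbil_add; apply: cbil_vmap.
  exact: (cbil_comp prR prH lb).
exact: (cbil_comp prH prR rb).
Qed.

Lemma mc_chi_bilinear : conformal_bilinear mc_chi.
Proof. by apply: cbil_vmap; exact: (cbil_comp prR prR cb). Qed.

Lemma mc_map_bilinear : conformal_bilinear mc_map.
Proof. exact: cbil_add mc_lr_bilinear mc_chi_bilinear. Qed.

Lemma ev2_mc_map n (p : cpoly K n) x y :
  ev2 mc_map p x y =
  vmap iH (ev2 (zl z) p (vmap prR x) (vmap prH y)
           + ev2 (zr z) (- partial - p) (vmap prR y) (vmap prH x)
           + ev2 (zchi z) p (vmap prR x) (vmap prR y)).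
Proof.
have b1 := cbil_comp prR prH lb; have b2 := cbil_comp prH prR rb.
have b3 := cbil_comp prR prR cb.
apply: (etrans (ev2_add p x y mc_lr_bilinear mc_chi_bilinear)).
rewrite vmapD; congr (_ + _); last first.
  apply: (etrans (ev2_vmap iH p x y b3)).
  by rewrite (ev2_comp prR prR p x y cb).
apply: (etrans (ev2_add p x y (cbil_vmap iH b1) (cbil_vmap iH b2))).
rewrite vmapD; congr (_ + _).
  apply: (etrans (ev2_vmap iH p x y b1)).
  by rewrite (ev2_comp prR prH p x y lb).
apply: (etrans (ev2_vmap iH p x y b2)).
by rewrite (ev2_comp prH prR p x y rb) (ev2_flip _ _ _ (zr_bilinear z)).
Qed.

End DirectSum.

Section BinaryCochains.
Variables (K : fieldType).

Lemma cbil0l (U V W : lmodType {poly K}) (f : U -> V -> vpoly 1 W) v :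
  conformal_bilinear f -> f 0 v = 0.
Proof. by case=> fl _ _ _; exact: morphD0 (klinearD (fl v)). Qed.

Lemma cbil0r (U V W : lmodType {poly K}) (f : U -> V -> vpoly 1 W) u :
  conformal_bilinear f -> f u 0 = 0.
Proof. by case=> _ fr _ _; exact: morphD0 (klinearD (fr u)). Qed.

Lemma I2P (P : 'I_2 -> Prop) : P ord0 -> P ord_max -> forall i, P i.
Proof.
move=> P0 P1 [[|[|i]] ilt] //.
  by rewrite (_ : Ordinal ilt = ord0) //; apply: val_inj.
by rewrite (_ : Ordinal ilt = ord_max) //; apply: val_inj.
Qed.

Lemma card_I2 (S : {set 'I_2}) : #|S| = ((ord0 \in S) + (ord_max \in S))%N.
Proof.
rewrite -sum1_card big_mkcond big_ord_recl big_ord1.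
rewrite (_ : lift ord0 ord0 = ord_max :> 'I_2); last exact: val_inj.
by case: (ord0 \in S); case: (ord_max \in S).
Qed.

Lemma is_cochain_binary (E : lmodType {poly K}) (G : E -> E -> vpoly 1 E) :
  conformal_bilinear G -> is_cochain (binary G).
Proof.
case=> Gl Gr GXl GXr; split.
- apply: I2P => a c u v; rewrite /binary !ffunE /=; [exact: Gl | exact: Gr].
- by apply: I2P => // a _; rewrite /binary !ffunE /=; exact: GXl.
- by move=> a; rewrite /binary !ffunE /= big_ord1; exact: GXr.
Qed.

End BinaryCochains.

Section Halves.
Variables (K : fieldType) (n : nat).
Hypothesis two : 2%:R != 0 :> K.

Lemma scal1 : scal (1%:R^-1 : K) = 1 :> cpoly K n.
Proof. by rewrite invr1 rmorph1. Qed.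

Lemma half_double (V : lmodType {poly K}) (x : vpoly n V) :
  (scal (2%:R^-1) : cpoly K n) *: (x + x) = x.
Proof.
have e : x + x = (2%:R : cpoly K n) *: x by rewrite scaler_nat mulr2n.
apply: (etrans (congr1 _ e)); rewrite scalerA.
by rewrite -(rmorph_nat (@scal K n)) -rmorphM mulVf // rmorph1 scale1r.
Qed.

(** The graded bracket is symmetric in degree one: dc = pi.c + c.pi, and half of [c, c] is c.c. *)
Lemma half_bracket (V : lmodType {poly K}) (P Q S : vpoly n V) :
  P + Q + S = 0 ->
  P - (-1) ^+ (1 * 1) *: Q
  + (scal (2%:R^-1) : cpoly K n) *: (S - (-1) ^+ (1 * 1) *: S) = 0.
Proof.
move=> <-; rewrite mul1n expr1 !scaleN1r !opprK.
exact: (congr1 (fun A => P + Q + A) (half_double S)).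
Qed.

End Halves.

Section MaurerCartan.
Variables (K : fieldType) (R H : leibnizConformalAlgebra K) (z : Z2nab R H).
Local Notation E := (dsum R H).
Local Notation iR := (@inR K R H).
Local Notation iH := (@inH K R H).
Local Notation pR := (@prR K R H).
Local Notation pH := (@prH K R H).
Local Notation br := (ev2 (@bracket K H)).
Local Notation brR := (ev2 (@bracket K R)).
Local Notation l := (ev2 (zl z)).
Local Notation r := (ev2 (zr z)).
Local Notation chi := (ev2 (zchi z)).
Local Notation Pi := (ev2 (@sum_bracket K R H)).
Local Notation C := (ev2 (mc_map z)).

Let lb := zl_bilinear z.
Let rb := zr_bilinear z.
Let fb := cbil_flip (zr_bilinear z).
Let cb := zchi_bilinear z.
Let hb := bracket_bilinear H.
Let Rb := bracket_bilinear R.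

Lemma in_dgla_mc : in_dgla (MC_of_cocycle z).
Proof.
exists (fun m : 'I_2 => if m == ord0 then binary (mc_lr z) else binary (mc_chi z)).
split; last first.
  by move=> a; rewrite big_ord_recl big_ord1 /=; exact: mc_mapE.
apply: I2P => /=; split.
- exact: is_cochain_binary (mc_lr_bilinear z).
- by move=> a k; rewrite /binary /mc_lr -vmapD vmap_coef.
- move=> S a aS aNS; rewrite !card_I2 !inE /binary /mc_lr.
  have := aS ord0; have := aS ord_max; have := aNS ord0; have := aNS ord_max.
  case: (ord0 \in S); case: (ord_max \in S) => //= H1 H2 H3 H4 nb.
  + have -> : pH (a ord0) = 0 := H4 isT; have -> : pH (a ord_max) = 0 := H3 isT.
    by rewrite (cbil0r _ lb) (cbil0l _ fb) !vmap0 addr0.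
  + by case: nb.
  + by case: nb.
  + have -> : pR (a ord0) = 0 := H2 isT; have -> : pR (a ord_max) = 0 := H1 isT.
    by rewrite (cbil0l _ lb) (cbil0r _ fb) !vmap0 addr0.
- exact: is_cochain_binary (mc_chi_bilinear z).
- by move=> a k; rewrite /binary /mc_chi vmap_coef.
- move=> S a aS aNS; rewrite !card_I2 !inE /binary /mc_chi.
  have := aNS ord0; have := aNS ord_max.
  case: (ord0 \in S); last first.
    move=> _ /(_ isT) e _; have -> : pR (a ord0) = 0 := e.
    by rewrite (cbil0l _ cb) vmap0.
  case: (ord_max \in S) => [_ _ []//|/(_ isT) e _ _].
  have -> : pR (a ord_max) = 0 := e.
  by rewrite (cbil0r _ cb) vmap0.
Qed.

Section Evaluations.
Variable n : nat.
Implicit Types (p q : cpoly K n) (x y w : vpoly n E) (s : vpoly n H).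

(** An H-valued argument has no R-component, so one term survives here and in the next three
    lemmas. *)
Lemma bracket_Hl p s y : Pi p (vmap iH s) y = vmap iH (br p s (vmap pH y)).
Proof.
apply: (etrans (ev2_sum_bracket _ _ _)).
by rewrite vmap_prR_inH vmap_prH_inH (ev20l Rb) vmap0 add0r.
Qed.

Lemma bracket_Hr p x s : Pi p x (vmap iH s) = vmap iH (br p (vmap pH x) s).
Proof.
apply: (etrans (ev2_sum_bracket _ _ _)).
by rewrite vmap_prR_inH vmap_prH_inH (ev20r Rb) vmap0 add0r.
Qed.

Lemma mc_Hl p s y :
  C p (vmap iH s) y = vmap iH (r (- partial - p) (vmap pR y) s).
Proof.
apply: (etrans (ev2_mc_map _ _ _ _)).
by rewrite vmap_prR_inH vmap_prH_inH (ev20l lb) (ev20l cb) add0r addr0.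
Qed.

Lemma mc_Hr p x s : C p x (vmap iH s) = vmap iH (l p (vmap pR x) s).
Proof.
apply: (etrans (ev2_mc_map _ _ _ _)).
by rewrite vmap_prR_inH vmap_prH_inH (ev20l rb) (ev20r cb) !addr0.
Qed.

Lemma prR_bracket p x y : vmap pR (Pi p x y) = brR p (vmap pR x) (vmap pR y).
Proof.
apply: (etrans (congr1 _ (ev2_sum_bracket _ _ _))).
apply: (etrans (vmapD _ _ _)); apply: etrans (addr0 _).
by apply: (congr2 (fun A B => A + B)); [exact: vmap_compK | exact: vmap_comp0].
Qed.

Lemma prH_bracket p x y : vmap pH (Pi p x y) = br p (vmap pH x) (vmap pH y).
Proof.
apply: (etrans (congr1 _ (ev2_sum_bracket _ _ _))).
apply: (etrans (vmapD _ _ _)); apply: etrans (add0r _).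
by apply: (congr2 (fun A B => A + B)); [exact: vmap_comp0 | exact: vmap_compK].
Qed.

(** The parameter p' lets - d - (l + m) appear in the form - d - l - m used by the identities. *)
Lemma mc_bracket_l p q x y w p' : - partial - p = p' ->
  C p (Pi q x y) w =
  vmap iH (l p (brR q (vmap pR x) (vmap pR y)) (vmap pH w)
           + r p' (vmap pR w) (br q (vmap pH x) (vmap pH y))
           + chi p (brR q (vmap pR x) (vmap pR y)) (vmap pR w)).
Proof.
move=> <-.
apply: (etrans (ev2_mc_map _ _ _ _)).
exact: (congr2 (fun A B => vmap iH (l p A (vmap pH w)
  + r (- partial - p) (vmap pR w) B + chi p A (vmap pR w)))
  (prR_bracket q x y) (prH_bracket q x y)).
Qed.

Lemma mc_bracket_r p q x y w : C p x (Pi q y w) =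
  vmap iH (l p (vmap pR x) (br q (vmap pH y) (vmap pH w))
           + r (- partial - p) (brR q (vmap pR y) (vmap pR w)) (vmap pH x)
           + chi p (vmap pR x) (brR q (vmap pR y) (vmap pR w))).
Proof.
apply: (etrans (ev2_mc_map _ _ _ _)).
exact: (congr2 (fun A B => vmap iH (l p (vmap pR x) B
  + r (- partial - p) A (vmap pH x) + chi p (vmap pR x) A))
  (prR_bracket q y w) (prH_bracket q y w)).
Qed.

Lemma bracket_mc_l p q x y w : Pi p (C q x y) w =
  vmap iH (br p (l q (vmap pR x) (vmap pH y)) (vmap pH w)
           + br p (r (- partial - q) (vmap pR y) (vmap pH x)) (vmap pH w)
           + br p (chi q (vmap pR x) (vmap pR y)) (vmap pH w)).
Proof.
apply: (etrans (congr1 (fun A => Pi p A w) (ev2_mc_map _ _ _ _))).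
apply: (etrans (bracket_Hl _ _ _)); congr (vmap iH _).
by rewrite (ev2Dl hb); congr (_ + _); exact: (ev2Dl hb).
Qed.

Lemma bracket_mc_r p q x y w : Pi p x (C q y w) =
  vmap iH (br p (vmap pH x) (l q (vmap pR y) (vmap pH w))
           + br p (vmap pH x) (r (- partial - q) (vmap pR w) (vmap pH y))
           + br p (vmap pH x) (chi q (vmap pR y) (vmap pR w))).
Proof.
apply: (etrans (congr1 (Pi p x) (ev2_mc_map _ _ _ _))).
apply: (etrans (bracket_Hr _ _ _)); congr (vmap iH _).
by rewrite (ev2Dr hb); congr (_ + _); exact: (ev2Dr hb).
Qed.

Lemma mc_mc_l p q x y w p' : - partial - p = p' ->
  C p (C q x y) w =
  vmap iH (r p' (vmap pR w) (l q (vmap pR x) (vmap pH y))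
           + r p' (vmap pR w)
               (r (- partial - q) (vmap pR y) (vmap pH x))
           + r p' (vmap pR w) (chi q (vmap pR x) (vmap pR y))).
Proof.
move=> <-.
apply: (etrans (congr1 (fun A => C p A w) (ev2_mc_map _ _ _ _))).
apply: (etrans (mc_Hl _ _ _)); congr (vmap iH _).
by rewrite (ev2Dr rb); congr (_ + _); exact: (ev2Dr rb).
Qed.

Lemma mc_mc_r p q x y w : C p x (C q y w) =
  vmap iH (l p (vmap pR x) (l q (vmap pR y) (vmap pH w))
           + l p (vmap pR x) (r (- partial - q) (vmap pR w) (vmap pH y))
           + l p (vmap pR x) (chi q (vmap pR y) (vmap pR w))).
Proof.
apply: (etrans (congr1 (C p x) (ev2_mc_map _ _ _ _))).
apply: (etrans (mc_Hr _ _ _)); congr (vmap iH _).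
by rewrite (ev2Dr lb); congr (_ + _); exact: (ev2Dr lb).
Qed.

End Evaluations.

Lemma vmap_alternating n (P Q S : vpoly n H) :
  vmap iH P - (vmap iH Q - vmap iH S) = vmap iH (P - (Q - S)).
Proof.
apply: esym; apply: (etrans (vmapD _ _ _)).
apply: (congr1 (fun A => vmap iH P + A)); apply: (etrans (vmapN _ _)).
apply: (congr1 -%R); apply: (etrans (vmapD _ _ _)).
exact: (congr1 (fun A => vmap iH Q + A) (vmapN _ _)).
Qed.

(** All three products take values in H, since c does and pi preserves H, so the equation can be
    checked in H. Patterns R, R, H and R, R, R are axioms (ii) and (iv) as they stand. *)
Lemma mc_equation (a : {ffun 'I_3 -> E}) :
  circ (@dsum_bracket K R H) (MC_of_cocycle z) a
  + circ (MC_of_cocycle z) (@dsum_bracket K R H) a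
  + circ (MC_of_cocycle z) (MC_of_cocycle z) a = 0 :> vpoly 2 E.
Proof.
have sb := sum_bracket_bilinear R H; have mb := mc_map_bilinear z.
have sE := @sum_bracketE K R H; have mE := mc_mapE z.
apply: (etrans (congr2 (fun A B => A + B)
  (congr2 (fun A B => A + B) (circ11 sE mE sb mb a) (circ11 mE sE mb sb a))
  (circ11 mE mE mb mb a))).
move: (a (inord 0)) (a (inord 1)) (a (inord 2)) => x y w.
have alt (A B D : vpoly 2 E) P Q S : A = vmap iH P -> B = vmap iH Q ->
    D = vmap iH S -> A - (B - D) = vmap iH (P - (Q - S)).
  by move=> -> -> ->; exact: vmap_alternating.
have pE : - partial - (lam + mu) = - partial - lam - mu :> cpoly K 2.
  by rewrite opprD addrA.
apply: (etrans (congr2 (fun A B => A + B) (congr2 (fun A B => A + B)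
  (alt _ _ _ _ _ _ (bracket_mc_l _ _ _ _ _) (bracket_mc_r _ _ _ _ _)
     (bracket_mc_r _ _ _ _ _))
  (alt _ _ _ _ _ _ (mc_bracket_l _ _ _ _ pE) (mc_bracket_r _ _ _ _ _)
     (mc_bracket_r _ _ _ _ _)))
  (alt _ _ _ _ _ _ (mc_mc_l _ _ _ _ pE) (mc_mc_r _ _ _ _ _)
     (mc_mc_r _ _ _ _ _)))).
have vH (A B D : vpoly 2 H) : vmap iH A + vmap iH B + vmap iH D =
  vmap iH (A + B + D).
  apply: esym; apply: (etrans (vmapD _ _ _)).
  exact: (congr1 (fun A => A + vmap iH D) (vmapD _ _ _)).
apply: (etrans (vH _ _ _)); rewrite -[RHS](vmap0 iH 2); congr (vmap iH _).
have Rv (e : E) : vmap pR (e%:V : vpoly 2 E) = (pR e)%:V := vmapV pR 2 e.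
have Hv (e : E) : vmap pH (e%:V : vpoly 2 E) = (pH e)%:V := vmapV pH 2 e.
generalize (Rv x) (Rv y) (Rv w) (Hv x) (Hv y) (Hv w).
generalize (vmap pR (x%:V : vpoly 2 E)) (vmap pR (y%:V : vpoly 2 E))
  (vmap pR (w%:V : vpoly 2 E)) (vmap pH (x%:V : vpoly 2 E))
  (vmap pH (y%:V : vpoly 2 E)) (vmap pH (w%:V : vpoly 2 E)).
move=> x1 y1 w1 x2 y2 w2 -> -> -> -> -> ->.
apply: combine_MC.
- exact: identity_RHH.
- exact: identity_HRH.
- exact: identity_HHR.
- exact: cocycle_ll.
- exact: identity_RHR.
- exact: identity_HRR.
- exact: cocycle_chi.
Qed.

Lemma is_MC_cocycle : 2%:R != 0 :> K -> is_MC (MC_of_cocycle z).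
Proof.
move=> two; split; first exact: in_dgla_mc.
by move=> a; exact: (half_bracket two (mc_equation a)).
Qed.

End MaurerCartan.

(** * The exponential action *)

Lemma finite_sum2 (K : fieldType) (R H : leibnizConformalAlgebra K) n
    (u : nat -> cochain (dsum R H) n) s : (forall k a, u k.+2 a = 0) ->
  finite_sum u s <-> s =1 (fun a => u 0 a + u 1 a).
Proof.
move=> u0; split=> [[N [uN sE]] a|sE].
  rewrite sE; apply: esym.
  (* The bound N may be 0 or 1; with N + 2 the two leading terms can always be split off. *)
  have -> : \sum_(k < N) u k a = \sum_(k < N.+2) u k a.
    by rewrite !big_ord_recr /= !uN ?addr0.
  rewrite !big_ord_recl big1 => [|k _]; first by rewrite addr0.
  exact: u0.
exists 2; split=> [k|a]; first by case: k => [|[|k]] // _ a; exact: u0.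
by rewrite big_ord_recl big_ord1 sE.
Qed.

Section Exponential.
Variables (K : fieldType) (R H : leibnizConformalAlgebra K).
Local Notation E := (dsum R H).
Local Notation iR := (@inR K R H).
Local Notation iH := (@inH K R H).
Local Notation pR := (@prR K R H).
Local Notation pH := (@prH K R H).
Local Notation br := (@bracket K H).
Local Notation brR := (@bracket K R).
Local Notation Pi := (@sum_bracket K R H).

Variable b : {linear R -> H}.

(** On H-valued cochains g, [alpha, g] is - g.alpha; the sign here makes it insert + b. *)
Definition twist (e : E) : E := iH (- b (pR e)).

Lemma twist_is_linear : linear twist.
Proof. by move=> c u v; rewrite /twist !linearP. Qed.

HB.instance Definition _ :=
  GRing.isLinear.Build {poly K} E E *:%R twist twist_is_linear.

Variable alpha : cochain E 0.
Hypothesis alphaE : alpha =1 unary twist.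

Lemma cbilNl (U V W : lmodType {poly K}) (f : U -> V -> vpoly 1 W) u v :
  conformal_bilinear f -> f (- u) v = - f u v.
Proof.
move=> fb; apply: (addrI (f u v)); have [fl _ _ _] := fb.
by rewrite -(klinearD (fl v)) !addrN (cbil0l _ fb).
Qed.

Lemma cbilNr (U V W : lmodType {poly K}) (f : U -> V -> vpoly 1 W) u v :
  conformal_bilinear f -> f u (- v) = - f u v.
Proof.
move=> fb; apply: (addrI (f u v)); have [_ fr _ _] := fb.
by rewrite -(klinearD (fr u)) !addrN (cbil0r _ fb).
Qed.

Lemma twist_inH n (x : vpoly n H) : vmap twist (vmap iH x) = 0.
Proof.
apply: vmap_comp0 => u; rewrite -[LHS]/(iH (- b 0)).
by rewrite linear0 oppr0 linear0.
Qed.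

(** The product alpha.g applies [twist] to values in H, where it vanishes; only g.alpha is left. *)
Lemma adj_binary (g : cochain E 1) G : g =1 binary G ->
  (forall x, G 0 x = 0) -> (forall x, G x 0 = 0) ->
  (forall x y, exists s, G x y = vmap iH s) ->
  adj alpha g =1 binary (fun x y => - (G (twist x) y + G x (twist y))).
Proof.
move=> gE G0l G0r Gs a; rewrite /adj /gbracket mul0n expr0.
have -> : circ alpha g a = 0.
  apply: (etrans (circ01 gE alphaE a)).
  by have [s ->] := Gs (a ord0) (a ord_max); exact: twist_inH.
rewrite sub0r scale1r; congr (- _).
exact: (circ10 gE alphaE G0l G0r a).
Qed.

Definition liftR (F : R -> R -> vpoly 1 H) (x y : E) : vpoly 1 E :=
  vmap iH (F (pR x) (pR y)).

(** Inserting [twist] puts an element without R-component where only the R-component counts. This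
    cuts both exponential series after two terms. *)
Lemma adj_liftR (g : cochain E 1) F : g =1 binary (liftR F) ->
  (forall x, F 0 x = 0) -> (forall x, F x 0 = 0) -> adj alpha g =1 (fun=> 0).
Proof.
move=> gE F0l F0r a; rewrite (adj_binary gE) => [|x|x|x y].
- by rewrite /binary /liftR /= F0l F0r !vmap0 addr0 oppr0.
- by rewrite /liftR linear0 F0l vmap0.
- by rewrite /liftR linear0 F0r vmap0.
- by exists (F (pR x) (pR y)).
Qed.

Lemma iter_adj0 (g : cochain E 1) k : g =1 (fun=> 0) ->
  iter k (@adj K R H alpha 1) g =1 (fun=> 0).
Proof.
(* The zero cochain is itself the lift of the zero map. *)
elim: k g => [|k IH] g g0 //=; apply: (@adj_liftR _ (fun _ _ => 0)) => // a.
by rewrite (IH _ g0) /binary /liftR vmap0.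
Qed.

Lemma vmap_sum3 n (A B V : vpoly n H) :
  vmap iH (- A) + vmap iH (- B) + vmap iH V = vmap iH (V - A - B).
Proof.
apply: esym; apply: (etrans (vmapD _ _ _)).
apply: (etrans (congr1 (fun X => X + vmap iH (- B)) (vmapD _ _ _))).
exact: etrans (esym (addrA _ _ _)) (addrC _ _).
Qed.

Section Cocycle.
Variable z : Z2nab R H.
Let lb := zl_bilinear z.
Let fb := cbil_flip (zr_bilinear z).
Let cb := zchi_bilinear z.
Let hb := bracket_bilinear H.
Let Rb := bracket_bilinear R.

Lemma mc_map_inHl h y : mc_map z (iH h) y = vmap iH (flip (zr z) h (pR y)).
Proof.
rewrite /mc_map /mc_lr /mc_chi [pR (iH h)](_ : _ = 0) // [pH (iH h)](_ : _ = h) //.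
by rewrite (cbil0l _ lb) (cbil0l _ cb) vmap0 add0r addr0.
Qed.

Lemma mc_map_inHr x h : mc_map z x (iH h) = vmap iH (zl z (pR x) h).
Proof.
rewrite /mc_map /mc_lr /mc_chi [pR (iH h)](_ : _ = 0) // [pH (iH h)](_ : _ = h) //.
by rewrite (cbil0r _ fb) (cbil0r _ cb) vmap0 !addr0.
Qed.

Lemma adj_mc : adj alpha (MC_of_cocycle z) =1
  binary (liftR (fun x y => zl z x (b y) + flip (zr z) (b x) y)).
Proof.
have mb := mc_map_bilinear z.
move=> a; rewrite (adj_binary (mc_mapE z)) => [|x|x|x y].
- rewrite /binary /liftR mc_map_inHl mc_map_inHr (cbilNl _ _ fb) (cbilNr _ _ lb).
  by rewrite !vmapN -opprD opprK addrC vmapD.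
- exact: cbil0l mb.
- exact: cbil0r mb.
- by rewrite /mc_map /mc_lr /mc_chi -!vmapD; eexists.
Qed.

(** The negative terms come from pi.alpha, the first one from - alpha.pi; the sign in [twist]
    reverses each. *)
Definition d_alpha (x y : E) : vpoly 1 H :=
  vmap b (brR (pR x) (pR y)) - br (b (pR x)) (pH y) - br (pH x) (b (pR y)).

Lemma sum_bracket_inHl h y : Pi (iH h) y = vmap iH (br h (pH y)).
Proof.
rewrite /sum_bracket [pR (iH h)](_ : _ = 0) // [pH (iH h)](_ : _ = h) //.
by rewrite (cbil0l _ Rb) vmap0 add0r.
Qed.

Lemma sum_bracket_inHr x h : Pi x (iH h) = vmap iH (br (pH x) h).
Proof.
rewrite /sum_bracket [pR (iH h)](_ : _ = 0) // [pH (iH h)](_ : _ = h) //.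
by rewrite (cbil0r _ Rb) vmap0 add0r.
Qed.

Lemma twist_inR n (x : vpoly n R) : vmap twist (vmap iR x) = - vmap iH (vmap b x).
Proof.
apply/malgP => k; apply: (etrans (vmap_comp_coef _ _ _ _)).
rewrite mcoeffN; apply: etrans (congr1 -%R (esym (vmap_comp_coef _ _ _ _))).
exact: (linearN (@inH K R H) (b (x@_k))).
Qed.

Lemma twist_bracket x y : vmap twist (Pi x y) = - vmap iH (vmap b (brR (pR x) (pR y))).
Proof.
apply: (etrans (vmapD _ _ _)); apply: etrans (addr0 _).
by apply: (congr2 (fun A B => A + B)); [exact: twist_inR | exact: twist_inH].
Qed.

Lemma differential_alpha :
  differential alpha =1 binary (fun x y => vmap iH (d_alpha x y)).
Proof.
have sb := sum_bracket_bilinear R H; have sE := @sum_bracketE K R H.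
move=> a; rewrite /differential /gbracket muln0 expr0.
have c1 := circ10 sE alphaE (fun x => cbil0l x sb) (fun x => cbil0r x sb) a.
have c2 := circ01 sE alphaE a.
apply: (etrans (congr2 (fun A B => A - 1 *: B) c1 c2)).
rewrite sum_bracket_inHl sum_bracket_inHr twist_bracket scale1r opprK.
rewrite (cbilNl _ _ hb) (cbilNr _ _ hb).
exact: vmap_sum3.
Qed.

Lemma d_alpha_inHl h y : d_alpha (iH h) y = - br h (b (pR y)).
Proof.
rewrite /d_alpha; have -> : brR (pR (iH h)) (pR y) = 0 := cbil0l _ Rb.
have -> : b (pR (iH h)) = 0 := linear0 b.
by rewrite (cbil0l _ hb) vmap0 subr0 sub0r.
Qed.

Lemma d_alpha_inHr x h : d_alpha x (iH h) = - br (b (pR x)) h.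
Proof.
rewrite /d_alpha; have -> : brR (pR x) (pR (iH h)) = 0 := cbil0r _ Rb.
have -> : b (pR (iH h)) = 0 := linear0 b.
by rewrite (cbil0r _ hb) vmap0 sub0r subr0.
Qed.

(** Both insertions yield the same term [b x, b y]; the factor 1/2! of the series removes this
    doubling. *)
Lemma adj_d_alpha : adj alpha (differential alpha) =1
  binary (liftR (fun x y => - (br (b x) (b y) + br (b x) (b y)))).
Proof.
move=> a; rewrite (adj_binary differential_alpha) => [|x|x|x y].
- apply: etrans _ (esym (etrans (vmapN _ _) (congr1 -%R (vmapD _ _ _)))).
  apply: (congr2 (fun A B => - (vmap iH A + vmap iH B))).
    by rewrite /twist d_alpha_inHl (cbilNl _ _ hb) opprK.
  by rewrite /twist d_alpha_inHr (cbilNr _ _ hb) opprK.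
- rewrite /d_alpha !linear0 (cbil0l _ Rb) !(cbil0l _ hb) vmap0.
  by rewrite !subr0 vmap0.
- rewrite /d_alpha !linear0 (cbil0r _ Rb) !(cbil0r _ hb) vmap0.
  by rewrite !subr0 vmap0.
- by eexists.
Qed.

End Cocycle.

End Exponential.

Section Equivalence.
Variables (K : fieldType) (R H : leibnizConformalAlgebra K).
Hypothesis two : 2%:R != 0 :> K.
Local Notation E := (dsum R H).
Local Notation iR := (@inR K R H).
Local Notation iH := (@inH K R H).
Local Notation pR := (@prR K R H).
Local Notation pH := (@prH K R H).
Local Notation br := (@bracket K H).
Local Notation brR := (@bracket K R).

Definition mc_value (z : Z2nab R H) (x y : E) : vpoly 1 H :=
  zl z (pR x) (pH y) + flip (zr z) (pH x) (pR y) + zchi z (pR x) (pR y).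

Lemma mc_valueE z a :
  MC_of_cocycle z a = vmap iH (mc_value z (a ord0) (a ord_max)).
Proof.
apply: (etrans (mc_mapE z a)); apply: esym; apply: (etrans (vmapD _ _ _)).
exact: (congr1 (fun A => A + _) (vmapD _ _ _)).
Qed.

(** The H-component of c + [alpha, c] - (d alpha + [alpha, d alpha] / 2). *)
Definition exp_value (b : {linear R -> H}) (z : Z2nab R H) (x y : E) :=
  mc_value z x y + (zl z (pR x) (b (pR y)) + flip (zr z) (b (pR x)) (pR y))
  - (d_alpha b x y - br (b (pR x)) (b (pR y))).

Section Action.
Variables (b : {linear R -> H}) (z : Z2nab R H) (alpha : cochain E 0).
Hypothesis alphaE : alpha =1 unary (twist b).

Let hb := bracket_bilinear H.
Let lb := zl_bilinear z.
Let fb := cbil_flip (zr_bilinear z).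

Lemma adj_adj_mc : adj alpha (adj alpha (MC_of_cocycle z)) =1 (fun=> 0).
Proof.
apply: (adj_liftR alphaE (adj_mc alphaE z)) => x.
  by rewrite linear0 (cbil0l _ lb) (cbil0l _ fb) addr0.
by rewrite linear0 (cbil0r _ lb) (cbil0r _ fb) addr0.
Qed.

Lemma adj_adj_d_alpha : adj alpha (adj alpha (differential alpha)) =1 (fun=> 0).
Proof.
apply: (adj_liftR alphaE (adj_d_alpha alphaE)) => x.
  by rewrite linear0 (cbil0l _ hb) addr0 oppr0.
by rewrite linear0 (cbil0r _ hb) addr0 oppr0.
Qed.

Lemma iter_adj_vanish (g : cochain E 1) (c : nat -> cpoly K 1) k a :
  adj alpha (adj alpha g) =1 (fun=> 0) ->
  c k.+2 *: iter k.+2 (@adj K R H alpha 1) g a = 0.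
Proof.
move=> g0; rewrite iterSr iterSr.
apply: (etrans (congr1 (fun A => c k.+2 *: A) (iter_adj0 alphaE k g0 a))).
exact: scaler0.
Qed.

Lemma exp_sum1 (u : cochain E 1) :
  finite_sum (fun k a => scal ((k`!)%:R^-1)
                *: iter k (@adj K R H alpha 1) (MC_of_cocycle z) a) u
  <-> u =1 (fun a => vmap iH (mc_value z (a ord0) (a ord_max)
        + (zl z (pR (a ord0)) (b (pR (a ord_max)))
           + flip (zr z) (b (pR (a ord0))) (pR (a ord_max))))).
Proof.
have vanish k a := @iter_adj_vanish (MC_of_cocycle z)
  (fun k => scal ((k`!)%:R^-1)) k a adj_adj_mc.
apply: (iff_trans (finite_sum2 _ vanish)).
have e a : scal (0`!%:R^-1) *: MC_of_cocycle z a +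
    scal (1`!%:R^-1) *: adj alpha (MC_of_cocycle z) a =
  vmap iH (mc_value z (a ord0) (a ord_max)
        + (zl z (pR (a ord0)) (b (pR (a ord_max)))
           + flip (zr z) (b (pR (a ord0))) (pR (a ord_max)))).
  rewrite !scal1 !scale1r; apply: esym; apply: (etrans (vmapD _ _ _)).
  exact: (congr2 (fun A B => A + B) (esym (mc_valueE z a))
    (esym (adj_mc alphaE z a))).
split=> uE a; first exact: etrans (uE a) (e a).
exact: etrans (uE a) (esym (e a)).
Qed.

Lemma exp_sum2 (u : cochain E 1) :
  finite_sum (fun k a => scal ((k.+1`!)%:R^-1)
                *: iter k (@adj K R H alpha 1) (differential alpha) a) u
  <-> u =1 (fun a => vmap iH (d_alpha b (a ord0) (a ord_max)
        - br (b (pR (a ord0))) (b (pR (a ord_max))))).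
Proof.
have vanish k a := @iter_adj_vanish (differential alpha)
  (fun k => scal ((k.+1`!)%:R^-1)) k a adj_adj_d_alpha.
apply: (iff_trans (finite_sum2 _ vanish)).
have e a : scal (1`!%:R^-1) *: differential alpha a +
    scal (2`!%:R^-1) *: adj alpha (differential alpha) a =
  vmap iH (d_alpha b (a ord0) (a ord_max)
        - br (b (pR (a ord0))) (b (pR (a ord_max)))).
  apply: etrans _ (esym (vmapD _ _ _)); apply: (congr2 (fun A B => A + B)).
    apply: (etrans (congr1 (fun A => A *: differential alpha a) (scal1 K 1))).
    exact: etrans (scale1r _) (differential_alpha alphaE a).
  apply: (etrans (congr1 _ (adj_d_alpha alphaE a))).
  rewrite /binary /liftR -vmapZ; congr (vmap iH _).
  by rewrite scalerN; congr (- _); exact: half_double.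
split=> uE a; first exact: etrans (uE a) (e a).
exact: etrans (uE a) (esym (e a)).
Qed.

(** Both finite sums are determined pointwise by alpha, so their existence together with the formula
    for c' is a single equation. *)
Lemma exp_action (c' : cochain E 1) :
  (exists e1 e2 : cochain E 1,
    [/\ finite_sum (fun k a => scal ((k`!)%:R^-1)
          *: iter k (@adj K R H alpha 1) (MC_of_cocycle z) a) e1,
        finite_sum (fun k a => scal ((k.+1`!)%:R^-1)
          *: iter k (@adj K R H alpha 1) (differential alpha) a) e2
      & c' =1 (fun a => e1 a - e2 a)]) <->
  c' =1 (fun a => vmap iH (exp_value b z (a ord0) (a ord_max))).
Proof.
have vB (A B : vpoly 1 H) : vmap iH A - vmap iH B = vmap iH (A - B).
  apply: esym; apply: (etrans (vmapD _ _ _)).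
  exact: (congr1 (fun X => _ + X) (vmapN _ _)).
split=> [[e1 [e2 [/exp_sum1 E1 /exp_sum2 E2 cE]]] a|cE].
  apply: (etrans (cE a)).
  by apply: (etrans (congr2 (fun A B => A - B) (E1 a) (E2 a))); exact: vB.
have [e1 E1] : exists e1 : cochain E 1, e1 =1 (fun a =>
    vmap iH (mc_value z (a ord0) (a ord_max)
        + (zl z (pR (a ord0)) (b (pR (a ord_max)))
           + flip (zr z) (b (pR (a ord0))) (pR (a ord_max))))).
  by eexists; exact: frefl.
have [e2 E2] : exists e2 : cochain E 1, e2 =1 (fun a =>
    vmap iH (d_alpha b (a ord0) (a ord_max)
        - br (b (pR (a ord0))) (b (pR (a ord_max))))).
  by eexists; exact: frefl.
exists e1; exists e2; split=> [||a].
- exact: (proj2 (exp_sum1 e1) E1).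
- exact: (proj2 (exp_sum2 e2) E2).
apply: (etrans (cE a)); apply: esym.
by apply: (etrans (congr2 (fun A B => A - B) (E1 a) (E2 a))); exact: vB.
Qed.

End Action.

End Equivalence.

(** * Elements of degree zero and linear maps from R to H *)

Section DegreeZero.
Variables (K : fieldType) (R H : leibnizConformalAlgebra K).
Local Notation E := (dsum R H).
Local Notation iR := (@inR K R H).
Local Notation iH := (@inH K R H).
Local Notation pR := (@prR K R H).

Lemma vpoly0_const (V : lmodType {poly K}) (x : vpoly 0 V) : x = (x@_mone)%:V.
Proof.
apply/malgP => k; have -> : k = mone by apply/eqP/cmP => -[].
by rewrite [RHS]mcoeffUU.
Qed.

Lemma poly_linear (V W : lmodType {poly K}) (f : V -> W) :
  (forall c u v, f (c%:P *: u + v) = c%:P *: f u + f v) ->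
  (forall u, f ('X *: u) = 'X *: f u) -> linear f.
Proof.
move=> fl fX.
have fD u v : f (u + v) = f u + f v.
  by have := fl 1 u v; rewrite polyC1 !scale1r.
have f0 : f 0 = 0 := morphD0 fD.
have fZ (p : {poly K}) u : f (p *: u) = p *: f u.
  elim/poly_ind: p u => [|p c IH] u; first by rewrite !scale0r f0.
  rewrite !scalerDl fD -!scalerA IH fX; congr (_ + _).
  by have := fl c u 0; rewrite f0 !addr0.
by move=> p u v; rewrite fD fZ.
Qed.

Lemma in_dgla_twist (b : {linear R -> H}) : in_dgla (unary (twist b)).
Proof.
exists (fun=> unary (twist b)); split=> [m|a]; last by rewrite big_ord1.
rewrite ord1; split.
- split=> // [i a c u v|a]; rewrite /unary !ffunE.
    by rewrite !ord1 linearP vconstD vconstZ.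
  have -> : ord_max = ord0 :> 'I_1 by rewrite ord1.
  by rewrite eqxx big_ord0 addr0 [twist b _]linearZ; exact: vconstX.
- move=> a k; rewrite /unary /vconst mcoeffU.
  by case: eqP => _; rewrite ?mulr1n ?mulr0n.
(* A set S not of type (1, 0) is empty, so the only argument lies in H. *)
- move=> S a _ aNS nS; rewrite /unary; have : (a ord0).1 = 0.
    apply: aNS; apply/negP => S0; apply: nS; split.
      apply/eqP/cards1P; exists ord0; apply/setP => i.
      by rewrite ord1 S0 inE eqxx.
    by apply/eqP; rewrite cards_eq0; apply/eqP/setP => i; rewrite ord1 !inE S0.
  move=> e; have -> : twist b (a ord0) = iH (- b 0) by rewrite /twist [pR _]e.
  by rewrite linear0 oppr0 linear0 vconst0.
Qed.

(** With no formal variables a cochain is its constant coefficient A. The cochain conditions make A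
    linear, and bidegree (1, 0) makes it kill H and take values in H. *)
Lemma in_dgla_unary (alpha : cochain E 0) :
  in_dgla alpha -> exists b : {linear R -> H}, alpha =1 unary (twist b).
Proof.
case=> f [/(_ ord0) [[fl _ fX] fval f0] fE].
pose A (e : E) := (f ord0 [ffun=> e])@_mone.
have ffE (a : {ffun 'I_1 -> E}) : a = [ffun=> a ord0].
  by apply/ffunP => i; rewrite ffunE ord1.
have AE e : f ord0 [ffun=> e] = (A e)%:V := vpoly0_const _.
have Al : linear A.
  apply: poly_linear => [c u v|u].
    have := fl ord0 [ffun=> 0] c u v.
    rewrite [upd _ _ _]ffE [upd _ _ u]ffE [upd _ _ v]ffE !ffunE eqxx !AE.
    by rewrite -vconstZ -vconstD => /vconst_inj.
  have := fX [ffun=> u].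
  rewrite [upd _ _ _]ffE !ffunE (_ : ord0 == ord_max) // !AE big_ord0 addr0.
  by rewrite -vconstX => /vconst_inj.
have A1 e : (A e).1 = 0 by exact: fval.
have AH h : A (iH h) = 0.
  have e : f ord0 [ffun=> iH h] = 0.
    (* The empty set places the argument in H, which is bidegree (0, 1). *)
    apply: (f0 set0) => [j|j _|[]]; first by rewrite inE.
      by rewrite ffunE.
    by rewrite cards0.
  by rewrite /A e mcoeff0.
have bl : linear (fun x : R => - (A (iR x)).2).
  move=> p u v; rewrite linearP Al.
  by rewrite -[(p *: A _ + A _).2]/(p *: (A (iR u)).2 + (A (iR v)).2) opprD scalerN.
pose bM := GRing.isLinear.Build {poly K} R H *:%R _ bl.
pose b : {linear R -> H} := HB.pack (fun x : R => - (A (iR x)).2) bM.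
exists b => a; rewrite fE big_ord1 (ffE a) AE /unary ffunE; congr _%:V.
case: (a ord0) => x h.
(* The factor 1 gives the sum the shape to which linearity of A applies. *)
have -> : (x, h) = 1 *: iR x + iH h :> E.
  by rewrite scale1r -[RHS]/(x + 0, 0 + h) addr0 add0r.
rewrite Al AH addr0 [LHS]scale1r -[RHS]/(iH (- b (1 *: x + 0))).
rewrite scale1r addr0 /= opprK.
by rewrite [LHS]surjective_pairing A1.
Qed.

End DegreeZero.

(** * Comparison of the two equivalences *)

Section Main.
Variables (K : fieldType) (R H : leibnizConformalAlgebra K).
Local Notation E := (dsum R H).
Local Notation iR := (@inR K R H).
Local Notation iH := (@inH K R H).
Local Notation pR := (@prR K R H).
Local Notation pH := (@prH K R H).
Local Notation br := (@bracket K H).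
Local Notation brR := (@bracket K R).

(** The involution l := - d - l, which passes between r and its flip. *)
Definition oppvar : 'I_1 -> cpoly K 1 := fun=> - partial - lam.

Lemma subst_opp_invol (V : lmodType {poly K}) (x : vpoly 1 V) :
  subst oppvar (subst oppvar x) = x.
Proof.
rewrite subst_comp -[RHS]substK; apply: eq_subst => i; rewrite ord1.
by rewrite rmorphB rmorphN /= csubX (csub_var _ _ ord0) opprB opprK addrC addrK.
Qed.

Lemma flipE (U V W : lmodType {poly K}) (f : U -> V -> vpoly 1 W) u v :
  conformal_bilinear f -> flip f v u = subst oppvar (f u v).
Proof. by move=> fb; exact: (ev2VV fb). Qed.

(** The left side adds up the right sides of the equations for l', r' and chi'; the right side is
    [exp_value]. *)
Lemma exp_value_sum (Z : zmodType) (A A' B B' C D F G J : Z) :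
  (A + A') + (B + B') + (C + D + F - G + J) =
  A + B + C + (D + F) - (G - A' - B' - J).
Proof.
rewrite !opprB !addrA; exact: (ACl (1*3*5*6*7*9*4*2*8))%AC.
Qed.

Lemma addr_sub_cancel (Z : zmodType) (A P Q : Z) : A + P - Q - A = P - Q.
Proof. by rewrite addrAC [A + P]addrC addrK. Qed.

(** Adding the three equations gives one direction. For the other, arguments in R x H, H x R and R x
    R isolate them one at a time, the equation for r after undoing the flip. *)
Lemma equiv_exp_value (z z' : Z2nab R H) :
  Z2nab_equiv z z' <->
  exists b : {linear R -> H}, forall x y, mc_value z' x y = exp_value b z x y.
Proof.
have hb := bracket_bilinear H; have Rb := bracket_bilinear R.
have l1 := zl_bilinear z; have l2 := zl_bilinear z'.
have r1 := zr_bilinear z; have r2 := zr_bilinear z'.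
have f1 := cbil_flip r1; have f2 := cbil_flip r2.
have c1 := zchi_bilinear z; have c2 := zchi_bilinear z'.
split=> [[b [e1 e2 e3]]|[b e]]; exists b.
  move=> x y; rewrite /mc_value /exp_value /d_alpha.
  apply: etrans _ (exp_value_sum _ _ _ _ _ _ _ _ _).
  apply: (congr2 (fun A B => A + B)); last exact: e3.
  apply: (congr2 (fun A B => A + B)).
    by rewrite -(e1 (pR x) (pH y)) addrC subrK.
  apply: (etrans (flipE (pR y) (pH x) r2)).
  have e4 : zr z' (pR y) (pH x) = zr z (pR y) (pH x)
      + ev2 br (- partial - lam) (pH x)%:V (b (pR y))%:V.
    by rewrite -(e2 (pR y) (pH x)) addrC subrK.
  apply: (etrans (congr1 (subst oppvar) e4)); apply: (etrans (substD _ _ _)).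
  apply: (congr2 (fun A B => A + B)); first exact: esym (flipE _ _ r1).
  apply: (etrans (congr1 (subst oppvar) (ev2VV hb _ _ _))).
  exact: subst_opp_invol.
have mRH w (a : R) (h : H) : mc_value w (iR a) (iH h) = zl w a h.
  rewrite -[LHS]/(zl w a h + flip (zr w) 0 0 + zchi w a 0).
  have fw := cbil_flip (zr_bilinear w).
  by rewrite (cbil0l _ fw) (cbil0r _ (zchi_bilinear w)) !addr0.
have mHR w (a : R) (h : H) : mc_value w (iH h) (iR a) = flip (zr w) h a.
  rewrite -[LHS]/(zl w 0 0 + flip (zr w) h a + zchi w 0 a).
  by rewrite (cbil0l _ (zl_bilinear w)) (cbil0l _ (zchi_bilinear w)) add0r addr0.
have mRR w (a c : R) : mc_value w (iR a) (iR c) = zchi w a c.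
  rewrite -[LHS]/(zl w a 0 + flip (zr w) 0 c + zchi w a c).
  have fw := cbil_flip (zr_bilinear w).
  by rewrite (cbil0r _ (zl_bilinear w)) (cbil0l _ fw) !add0r.
split=> [a h|a h|a c].
- rewrite -(mRH z') -(mRH z) e /exp_value addr_sub_cancel.
  rewrite -[LHS]/(zl z a (b 0) + flip (zr z) (b a) 0
    - (vmap b (brR a 0) - br (b a) h - br 0 (b 0) - br (b a) (b 0))).
  rewrite linear0 (cbil0r _ l1) (cbil0r _ f1) (cbil0r _ Rb) (cbil0l _ hb).
  by rewrite (cbil0r _ hb) vmap0 !subr0 sub0r opprK addr0 add0r.
- apply: etrans _ (esym (ev2VV hb _ _ _)).
  have <- : flip (zr z') h a - flip (zr z) h a = br h (b a).
    rewrite -(mHR z') -(mHR z) e /exp_value addr_sub_cancel.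
    rewrite -[LHS]/(zl z 0 (b a) + flip (zr z) (b 0) a
      - (vmap b (brR 0 a) - br (b 0) 0 - br h (b a) - br (b 0) (b a))).
    rewrite linear0 (cbil0l _ l1) (cbil0l _ f1) (cbil0l _ Rb) (cbil0r _ hb).
    by rewrite (cbil0l _ hb) vmap0 !subr0 sub0r opprK addr0 add0r.
  apply: esym; apply: (etrans (substB _ _ _)).
  by apply: (congr2 (fun A B => A - B));
    apply: (etrans (congr1 (subst oppvar) (flipE _ _ _)));
    try exact: subst_opp_invol.
- rewrite -(mRR z') -(mRR z) e /exp_value.
  rewrite -[RHS]/(mc_value z (iR a) (iR c) + zl z a (b c) + flip (zr z) (b a) c
    - vmap b (brR a c) + br (b a) (b c)).
  rewrite -[LHS]/(mc_value z (iR a) (iR c) + (zl z a (b c) + flip (zr z) (b a) c)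
    - (vmap b (brR a c) - br (b a) 0 - br 0 (b c) - br (b a) (b c))).
  by rewrite (cbil0r _ hb) (cbil0l _ hb) !subr0 opprB addrA addrA addrAC.
Qed.

Lemma Z2nab_equiv_MC_equiv (z z' : Z2nab R H) : 2%:R != 0 :> K ->
  Z2nab_equiv z z' <-> MC_equiv (MC_of_cocycle z) (MC_of_cocycle z').
Proof.
move=> two; apply: (iff_trans (equiv_exp_value z z')); split=> [[b e]|].
  split; [exact: is_MC_cocycle | exact: is_MC_cocycle |].
  have aE : unary (twist b) =1 unary (twist b) by [].
  have [|e1 [e2 [h1 h2 h3]]] :=
      proj2 (exp_action two z aE (MC_of_cocycle z')) _.
    by move=> a; rewrite -e; exact: mc_valueE.
  exists (unary (twist b)), e1, e2; split=> //; exact: in_dgla_twist.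
case=> _ _ [alpha [e1 [e2 [/in_dgla_unary[b aE] h1 h2 h3]]]]; exists b => x y.
have := proj1 (exp_action two z aE (MC_of_cocycle z'))
  (ex_intro _ e1 (ex_intro _ e2 (And3 h1 h2 h3))).
move=> /(_ [ffun i => if i == ord0 then x else y]); rewrite mc_valueE !ffunE /=.
exact: vmap_inH_inj.
Qed.

End Main.

Theorem theorem4p6 (T : realType) (R H : leibnizConformalAlgebra (complex T))
    (z z' : Z2nab R H) :
  Z2nab_equiv z z' <-> MC_equiv (MC_of_cocycle z) (MC_of_cocycle z').
Proof. by apply: Z2nab_equiv_MC_equiv; rewrite Num.Theory.pnatr_eq0. Qed.
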